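(* Let $b$ be a finite Blaschke product with $N$ zeros and $C_b=\pi(J^{1/2})\Gamma_b$. (1) If a Cuntz family $S=\{S_i\}_{i=1}^N$ on $L^2(\mathbb{T})$ satisfies $\alpha_S\circ\pi=\pi\circ\beta$ on $L^\infty(\mathbb{T})$, then there is an orthonormal basis $\{m_i\}_{i=1}^N$ of the Hilbert module $L^\infty(\mathbb{T})_{\mathcal{L}}$ such that $S_i=\pi(m_i)C_b$ for $1\le i\le N$. (2) If $\{m_i\}_{i=1}^N\subseteq L^\infty(\mathbb{T})$ is such that the operators $S_i=\pi(m_i)C_b$ form a Cuntz family $S$ with $\alpha_S\circ\pi=\pi\circ\beta$, then $\{m_i\}_{i=1}^N$ is an orthonormal basis of $L^\infty(\mathbb{T})_{\mathcal{L}}$. (3) Conversely, if $\{m_i\}_{i=1}^N$ is any orthonormal basis of $L^\infty(\mathbb{T})_{\mathcal{L}}$ and $S_i=\pi(m_i)C_b$, then $S=\{S_i\}_{i=1}^N$ is a Cuntz family on $L^2(\mathbb{T})$ and $\alpha_S\circ\pi=\pi\circ\beta$ on $L^\infty(\mathbb{T})$.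
   Context: $b=\prod_{j=1}^N b_{\alpha_j}$ is a finite Blaschke product with $N$ zeros in $\mathbb{D}$ ($b_w(z)=\frac{|w|}{w}\frac{w-z}{1-\overline{w}z}$, $b_0(z)=z$); $\beta(\varphi)=\varphi\circ b$ on $L^\infty(\mathbb{T})$. $\pi(\varphi)$ is multiplication by $\varphi$ on $L^2(\mathbb{T})$; $\Gamma_b\xi=\xi\circ b$ (bounded on $L^2(\mathbb{T})$). $J$ is the outer function with $J(0)>0$ and $|J|=J_0$ on $\mathbb{T}$ where $J_0(z)=\frac{zb'(z)}{Nb(z)}$; $J^{1/2}$ its outer square root. The transfer operator is $\mathcal{L}(\xi)(z)=\frac1N\sum_{b(w)=z}\xi(w)$. The Hilbert $C^*$-module $L^\infty(\mathbb{T})_{\mathcal{L}}$ is $L^\infty(\mathbb{T})$ with right action $\xi\cdot a=\xi\beta(a)$ and $L^\infty(\mathbb{T})$-valued inner product $\langle\xi,\eta\rangle=\mathcal{L}(\overline{\xi}\eta)$. A family $\{m_i\}_{i=1}^N$ is an orthonormal basis of it iff $\langle m_i,m_j\rangle=\delta_{ij}\mathbf{1}$ and $f=\sum_{i=1}^N m_i\cdot\langle m_i,f\rangle=\sum_i m_i\,\beta(\mathcal{L}(\overline{m_i}f))$ for all $f\in L^\infty(\mathbb{T})$. A Cuntz family $\{S_i\}$ on $H$ is a family of isometries with $S_i^*S_j=\delta_{ij}I$, $\sum_iS_iS_i^*=I$, and $\alpha_S(T)=\sum_iS_iTS_i^*$. *)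

(* Defs.v *)
From HB Require Import structures.
From mathcomp Require Import all_boot all_order all_algebra.
From mathcomp Require Import all_classical all_reals all_analysis.
From mathcomp Require Import complex.
Set Implicit Arguments. Unset Strict Implicit. Unset Printing Implicit Defensive.
Import Order.TTheory GRing.Theory Num.Theory ComplexField numFieldNormedType.Exports.
Local Open Scope classical_set_scope.
Local Open Scope ring_scope.

Section Defs.
Context {R : realType}.
Local Notation C := (R[i]).
Local Notation mu := (@lebesgue_measure R).

(** The unit circle T, parametrised by t in [0, 2 pi]; functions on T are
    functions C -> C, of which only the values on T matter. *)
Definition eit (t : R) : C := (cos t +i* sin t)%C.
Definition dom : set R := `[0, pi *+ 2]%classic.

Definition aeT (P : R -> Prop) : Prop :=
  exists Nn : set R, mu.-negligible Nn /\ forall t, dom t -> ~ Nn t -> P t.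

Definition reT (f : C -> C) (t : R) : R := complex.Re (f (eit t)).
Definition imT (f : C -> C) (t : R) : R := complex.Im (f (eit t)).
Definition abs2T (f : C -> C) (t : R) : R := reT f t ^+ 2 + imT f t ^+ 2.

Definition measT (f : C -> C) : Prop :=
  measurable_fun dom (reT f) /\ measurable_fun dom (imT f).

Definition L2 (f : C -> C) : Prop :=
  measT f /\ mu.-integrable dom (fun t => (abs2T f t)%:E).

Definition Linf (f : C -> C) : Prop :=
  measT f /\ exists M : R, aeT (fun t => abs2T f t <= M).

Definition aeq (f g : C -> C) : Prop := aeT (fun t => f (eit t) = g (eit t)).

Definition integT (h : R -> R) : R := Rintegral mu dom h.

Definition cintT (h : R -> C) : C :=
  ((integT (fun t => complex.Re (h t)) +i* integT (fun t => complex.Im (h t)))%C)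
  / (pi *+ 2)%:C%C.

Definition inner (f g : C -> C) : C := cintT (fun t => (f (eit t))^* * g (eit t)).
Definition norm2 (f : C -> C) : R := Num.sqrt (integT (abs2T f) / (pi *+ 2)).

(** operators on L^2(T) are represented by maps on representatives *)
Definition op := (C -> C) -> (C -> C).

Definition bounded_op (S : op) : Prop :=
  [/\ (forall f, L2 f -> L2 (S f)),
      (forall f g, L2 f -> L2 g -> aeq f g -> aeq (S f) (S g)),
      (forall (a : C) f g, L2 f -> L2 g ->
          aeq (S (fun z => a * f z + g z)) (fun z => a * S f z + S g z)) &
      exists c : R, forall f, L2 f -> norm2 (S f) <= c * norm2 f].

Definition is_adjoint (S A : op) : Prop :=
  bounded_op A /\ forall f g, L2 f -> L2 g -> inner (S f) g = inner f (A g).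

Definition cuntz_family (N : nat) (S A : 'I_N -> op) : Prop :=
  [/\ (forall i, bounded_op (S i)),
      (forall i, is_adjoint (S i) (A i)),
      (forall i j f, L2 f -> aeq (A i (S j f)) (fun z => (i == j)%:R * f z)) &
      (forall f, L2 f -> aeq (fun z => \sum_(i < N) S i (A i f) z) f)].

(** alpha_S o pi = pi o beta on L^oo(T), where alpha_S(T) = sum_i S_i T S_i^* *)
Definition alpha_cov (N : nat) (S A : 'I_N -> op) (b : C -> C) : Prop :=
  forall phi, Linf phi -> forall f, L2 f ->
    aeq (fun z => \sum_(i < N) S i (fun w => phi w * A i f w) z)
        (fun z => phi (b z) * f z).

Definition bfactor (w z : C) : C :=
  if w == 0 then z else (`|w| / w) * ((w - z) / (1 - w^* * z)).
Definition blaschke (N : nat) (alpha : 'I_N -> C) (z : C) : C :=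
  \prod_(j < N) bfactor (alpha j) z.

Definition is_cderiv (f : C -> C) (z d : C) : Prop :=
  forall e : R, 0 < e -> exists2 del : R, 0 < del & forall h : C,
    0 < `|h| -> `|h| < del%:C%C -> `|(f (z + h) - f z) / h - d| < e%:C%C.
Definition cderiv (f : C -> C) (z : C) : C := xget 0 [set d | is_cderiv f z d].

Definition J0 (N : nat) (alpha : 'I_N -> C) (z : C) : C :=
  z * cderiv (blaschke alpha) z / (N%:R * blaschke alpha z).

Definition cexp (w : C) : C :=
  ((expR (complex.Re w) * cos (complex.Im w)) +i*
   (expR (complex.Re w) * sin (complex.Im w)))%C.

(** Herglotz integral of log J_0: the outer function J = exp(H) with
    J(0) > 0 and |J| = J_0 on T *)
Definition herglotzJ (N : nat) (alpha : 'I_N -> C) (z : C) : C :=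
  cintT (fun s => (eit s + z) / (eit s - z) *
                  (ln (complex.Re (J0 alpha (eit s))))%:C%C).

Definition Jhalf_in (N : nat) (alpha : 'I_N -> C) (z : C) : C :=
  cexp (herglotzJ alpha z / 2).

Definition Jhalf (N : nat) (alpha : 'I_N -> C) (z : C) : C :=
  ((lim ((fun r : R => (complex.Re (Jhalf_in alpha (r%:C%C * z)) : R)) @ at_left (1 : R))) +i*
   (lim ((fun r : R => (complex.Im (Jhalf_in alpha (r%:C%C * z)) : R)) @ at_left (1 : R))))%C.

Definition Cb (N : nat) (alpha : 'I_N -> C) : op :=
  fun f z => Jhalf alpha z * f (blaschke alpha z).

Definition mCb (N : nat) (alpha : 'I_N -> C) (m : C -> C) : op :=
  fun f z => m z * Cb alpha f z.

Definition transfer (N : nat) (alpha : 'I_N -> C) (xi : C -> C) (z : C) : C :=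
  N%:R^-1 * \sum_(w \in [set w | blaschke alpha w = z]) xi w.

(** orthonormal basis of the Hilbert module L^oo(T)_L :
    <xi,eta> = L(conj xi * eta), xi . a = xi * (a o b) *)
Definition onb (N : nat) (alpha : 'I_N -> C) (m : 'I_N -> C -> C) : Prop :=
  [/\ (forall i, Linf (m i)),
      (forall i j, aeq (transfer alpha (fun w => (m i w)^* * m j w))
                       (fun _ => (i == j)%:R)) &
      (forall f, Linf f -> aeq f (fun z => \sum_(i < N)
           m i z * transfer alpha (fun w => (m i w)^* * f w) (blaschke alpha z)))].

End Defs.

(* Main.v *)
(** Write b(e^{it}) = e^{i phi(t)} with phi increasing and phi' = N J_0: each
    Blaschke factor contributes t + 2 arg(1 - a e^{-it}) to phi and its
    Poisson kernel to phi'.  The points of the fibre of b over e^{iy} are then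
    e^{i psi(y + 2 pi k)}, k < N, where psi inverts phi, and a change of
    variable gives int L(h) = int J_0 h; hence the preimage and the image of a
    null set under b are null.  As log J_0 is Lipschitz on the circle, its
    Herglotz integral has radial limits everywhere by dominated convergence,
    so |J^{1/2}|^2 = J_0.

    It follows that the adjoint of pi(m) C_b is g |-> L(conj(m) g / J^{1/2}),
    and that S_i^* S_j = delta_ij and sum_i S_i S_i^* = 1 translate into
    orthonormality and completeness of (m_i).  In (1), covariance gives
    S_i(p g) = (p o b) S_i g, so S_i is determined by m_i = S_i(1) / J^{1/2}. *)
Require Import Defs.
From HB Require Import structures.
From mathcomp Require Import all_boot all_order all_algebra.
From mathcomp Require Import all_classical all_reals all_analysis measurable_realfun.
From mathcomp Require Import complex ring lra.
Set Implicit Arguments. Unset Strict Implicit. Unset Printing Implicit Defensive.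
Import Order.TTheory GRing.Theory Num.Theory ComplexField numFieldNormedType.Exports.
Local Open Scope classical_set_scope.
Local Open Scope ring_scope.

(** Functions and operators are handled through representatives, so composition with b, the transfer
    operator and the operators built from them respect almost-everywhere equality only because b
    carries null sets to null sets in both directions. Moreover [transfer] sums over all complex
    solutions of b(w) = z, a priori also off the circle, and at a pole of b division by zero returns
    0; the fibre has to be confined to the circle first.

    The main obstacle afterwards is unboundedness. Covariance and completeness can be tested only on
    bounded functions, whereas f in L2 is unbounded and the m_i built in (1) are at first merely
    measurable. The weight 1 / (1 + |f|^2) is bounded, nowhere zero, and makes f bounded; it is
    inserted, moved across the operator and cancelled. Boundedness of m_i comes out of
    orthonormality: a point lies in its own fibre, hence |m|^2 <= N L(|m|^2) o b = N.

    The adjoints in (1) and (2) are arbitrary maps satisfying the adjoint identity, so they are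
    matched with the explicit formula by a uniqueness argument. *)

Section density_measure.
Context {d : measure_display} {T : measurableType d} {R : realType}.
Variables (mu : {measure set T -> \bar R}) (p : T -> R).
Hypotheses (mp : measurable_fun setT p) (p0 : forall x, 0 <= p x).

Definition density_measure
  of measurable_fun setT p & (forall x, 0 <= p x) : set T -> \bar R :=
  fun A => (\int[mu]_(x in A) (p x)%:E)%E.

Local Notation nu := (density_measure mp p0).

Let nu0 : nu set0 = 0%E. Proof. exact: integral_set0. Qed.

Let nu_ge0 A : (0 <= nu A)%E.
Proof. by apply: integral_ge0 => x _; rewrite lee_fin. Qed.

Let nu_sigma_additive : semi_sigma_additive nu.
Proof.
move=> /= F mF tF mUF; rewrite /density_measure ge0_integral_bigcup//.
- by apply: is_cvg_ereal_nneg_natsum_cond => n _ _; exact: nu_ge0.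
- by apply/measurable_EFinP; exact: measurable_funTS.
- by move=> x _; rewrite lee_fin.
Qed.

HB.instance Definition _ :=
  isMeasure.Build _ _ _ nu nu0 nu_ge0 nu_sigma_additive.

Import HBNNSimple.

(** Both sides commute with the increasing limit over [nnsfun_approx], so only the indicators of the
    level sets of a simple function have to be compared. *)
Lemma integral_density_measure (f : T -> \bar R) :
  measurable_fun setT f -> (forall x, (0 <= f x)%E) ->
  (\int[nu]_x f x = \int[mu]_x (f x * (p x)%:E))%E.
Proof.
move=> mf f0; pose f_ := nnsfun_approx measurableT mf.
have mpE : measurable_fun setT (fun x => (p x)%:E) by exact/measurable_EFinP.
have cf x : (f_ n x)%:E @[n --> \oo] --> f x by exact: cvg_nnsfun_approx.
transitivity (limn (fun n => \int[nu]_x (f_ n x)%:E)%E).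
  rewrite -monotone_convergence//=.
  - by apply: eq_integral => x _; exact/esym/cvg_lim.
  - by move=> n; exact/measurable_EFinP/measurable_funTS.
  - by move=> n x _; rewrite lee_fin.
  - by move=> x _ m n mn; rewrite lee_fin; exact/lefP/nd_nnsfun_approx.
transitivity (limn (fun n => \int[mu]_x ((f_ n x)%:E * (p x)%:E))%E); last first.
  rewrite -monotone_convergence//=.
  - apply: eq_integral => x _; apply/cvg_lim => //.
    by apply: cvgeZr => //; exact: cf.
  - by move=> n; apply: emeasurable_funM => //; exact/measurable_EFinP/measurable_funTS.
  - by move=> n x _; rewrite -EFinM lee_fin mulr_ge0.
  - move=> x _ m n mn; rewrite -!EFinM lee_fin ler_wpM2r//.
    exact/lefP/nd_nnsfun_approx.
congr (limn _); apply/funext => n; set h := f_ n.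
have mh r : measurable (h @^-1` [set r]).
  by rewrite -(setTI (_ @^-1` _)); exact: (measurable_funP h).
transitivity (\sum_(k \in range h) \int[mu]_x
    (k%:E * ((p x)%:E * (\1_(h @^-1` [set k]) x)%:E)))%E.
  under eq_integral do rewrite fimfunE -fsumEFin//.
  rewrite ge0_integral_fsum//; last 2 first.
  - by move=> r; exact/measurable_EFinP/measurable_funM.
  - by move=> r x _; rewrite nnfun_muleindic_ge0.
  apply: eq_fsbigr => r /set_mem [x _ <-].
  rewrite integralZl_indic_nnsfun// integral_indic//= setIT ge0_integralZl//=.
  - congr (_ * _)%E; rewrite /density_measure integral_mkcond.
    by apply: eq_integral => y _; rewrite epatch_indic.
  - by apply: emeasurable_funM => //; exact/measurable_EFinP.
  - by move=> y _; rewrite -EFinM lee_fin mulr_ge0.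
  - by rewrite lee_fin.
transitivity (\int[mu]_x \sum_(k \in range h)
    (k%:E * ((p x)%:E * (\1_(h @^-1` [set k]) x)%:E)))%E; last first.
  apply: eq_integral => x _; rewrite (fimfunE h x) -fsumEFin//.
  rewrite ge0_mule_fsuml//; last by move=> r; rewrite nnfun_muleindic_ge0.
  by apply: eq_fsbigr => r _; rewrite EFinM -muleA; congr (_ * _)%E; rewrite muleC.
rewrite ge0_integral_fsum//.
- move=> r; apply: emeasurable_funM => //; apply: emeasurable_funM => //.
  exact/measurable_EFinP.
- by move=> r x _; rewrite muleCA mule_ge0 ?nnfun_muleindic_ge0 // lee_fin.
Qed.

End density_measure.

(** * Change of variable along an increasing bijection of the line *)

Section change_of_variable.
Context {R : realType}.
Local Notation mu := (@lebesgue_measure R).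
Variables (phi psi p : R -> R).
Hypotheses (cp : continuous p) (p0 : forall x, 0 <= p x).
Hypothesis dphi : forall x : R, is_derive x (1 : R) phi (p x).
Hypotheses (phiK : cancel phi psi) (psiK : cancel psi phi).
Hypothesis phi_mono : {mono phi : x y / x <= y}.

Lemma integral_derivative (a b : R) : a <= b ->
  (\int[mu]_(x in `]a, b]) (p x)%:E = (phi b - phi a)%:E)%E.
Proof.
have cphi : continuous phi.
  by move=> x; apply/differentiable_continuous/derivable1_diffP; case: (dphi x).
rewrite le_eqVlt => /predU1P[->|ab].
  by rewrite set_itvoc0 integral_set0 subrr.
rewrite integral_itv_obnd_cbnd; last first.
  apply/measurable_EFinP/measurable_funTS.
  exact: continuous_measurable_fun.
rewrite (@continuous_FTC2 _ _ phi)//.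
- exact: continuous_subspaceT.
- split; first by move=> x _; case: (dphi x).
  + exact/cvg_at_right_filter/cphi.
  + exact/cvg_at_left_filter/cphi.
- by move=> x _; rewrite derive1E; case: (dphi x).
Qed.

(** Lebesgue measure is the only measure giving ]a, b] the mass b - a. The image under phi of the
    measure with density p has this property, because p integrates to b - a over ]psi a, psi b]. *)
Lemma ge0_change_of_variable (g : R -> \bar R) :
  measurable_fun setT g -> (forall x, (0 <= g x)%E) ->
  (\int[mu]_x g x = \int[mu]_x (g (phi x) * (p x)%:E))%E.
Proof.
move=> mg g0.
have mphi : measurable_fun setT phi.
  by apply: nondecreasing_measurable => // x y; rewrite phi_mono.
have mp : measurable_fun setT p by exact: continuous_measurable_fun.
pose nu' : {measure set (measurableTypeR R) -> \bar R} :=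
  pushforward (density_measure mu mp p0)
    (phi : measurableTypeR R -> measurableTypeR R).
pose nu := nu' mphi.
have mu_nu A : measurable A -> mu A = nu A.
  apply: lebesgue_measure_unique => _ [[a b] _ <-] /=.
  rewrite lebesgue_measure_itv/= /nu /pushforward /= /density_measure.
  have -> : phi @^-1` `]a, b] = `]psi a, psi b]%classic.
    apply/funext => x /=; rewrite !in_itv/=.
    by rewrite -{1}(psiK a) -{1}(psiK b) phi_mono !ltNge phi_mono.
  have [ab|ba] := leP a b.
    rewrite integral_derivative; last by rewrite -phi_mono !psiK.
    by rewrite !psiK; move: ab; rewrite le_eqVlt lte_fin => /predU1P[->|->//];
      rewrite ltxx subrr.
  rewrite lte_fin ltNge (ltW ba)/= set_itv_ge ?integral_set0//.
  by rewrite bnd_simp -leNgt -phi_mono !psiK ltW.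
transitivity (\int[nu]_x g x)%E.
  by apply: eq_measure_integral => A mA _; exact: mu_nu.
rewrite ge0_integral_pushforward// preimage_setT integral_density_measure//=.
exact: measurableT_comp.
Qed.

End change_of_variable.

(** * Integrals of periodic functions *)

Section periodic_integral.
Context {R : realType}.
Local Notation mu := (@lebesgue_measure R).
Implicit Types (g : R -> \bar R) (a b c T : R).

Lemma itvco_disjoint a b c : [disjoint `[a, b[%classic & `[b, c[%classic].
Proof.
apply/disj_setPS => x /= []; rewrite !in_itv/= => /andP[_ xb] /andP[bx _].
by move: (lt_le_trans xb bx); rewrite ltxx.
Qed.

Lemma ge0_integral_itvco_split g a b c : measurable_fun setT g ->
  (forall x, 0 <= g x)%E -> a <= b -> b <= c ->
  (\int[mu]_(x in `[a, c[) g x =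
   \int[mu]_(x in `[a, b[) g x + \int[mu]_(x in `[b, c[) g x)%E.
Proof.
move=> mg g0 ab bc.
rewrite -ge0_integral_setU//; first last.
- exact: itvco_disjoint.
- exact: measurable_funTS.
by rewrite -itv_bndbnd_setU ?bnd_simp.
Qed.

Lemma ge0_integral_itvco_translate g a b c : measurable_fun setT g ->
  (forall x, 0 <= g x)%E ->
  (\int[mu]_(x in `[a, b[) g (x + c)%R =
   \int[mu]_(x in `[(a + c)%R, (b + c)%R[) g x)%E.
Proof.
move=> mg g0; rewrite [RHS]integral_mkcond [LHS]integral_mkcond.
have dc (x : R) : is_derive x (1 : R) (fun x => x + c) (cst 1 x).
  by rewrite -[cst 1 x]addr0 [cst 1 x]/(1 : R); exact: is_deriveD.
rewrite [RHS](@ge0_change_of_variable _ _ (fun x => x - c) (cst 1) _ _ dc)//.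
- apply: eq_integral => x _; rewrite mule1 !patchE !mem_setE !in_itv/=.
  by rewrite lerD2r ltrD2r.
- by move=> x; apply: cst_continuous.
- by move=> x; rewrite subrK.
- by move=> x y; rewrite lerD2r.
- by apply/(measurable_restrictT _ _).1 => //; exact: measurable_funTS.
- by move=> x; exact: erestrict_ge0.
Qed.

Lemma periodic_natmul (X : Type) (f : R -> X) T (k : nat) x :
  (forall y, f (y + T) = f y) -> f (x + T *+ k) = f x.
Proof.
move=> pf; elim: k => [|k IH]; first by rewrite mulr0n addr0.
by rewrite mulrSr addrA pf.
Qed.

Lemma periodic_intmul (X : Type) (f : R -> X) T (k : int) x :
  (forall y, f (y + T) = f y) -> f (x + T *~ k) = f x.
Proof.
move=> pf; case: k => k; first exact: periodic_natmul.
by rewrite NegzE mulrNz -pmulrn -[in RHS](subrK (T *+ k.+1) x) periodic_natmul.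
Qed.

Definition modT T x := x - T *~ Num.floor (x / T).

Lemma modT_itv T x : 0 < T -> 0 <= modT T x < T.
Proof.
move=> T0; rewrite /modT subr_ge0 ltrBlDr -mulrzr -[X in _ < X + _]mulr1 -mulrDr.
rewrite -ler_pdivlMl// -ltr_pdivrMl// mulrC floor_le /=.
by have := floorD1_gt (T^-1 * x); rewrite intrD addrC.
Qed.

Lemma periodic_modT (X : Type) (f : R -> X) T x :
  (forall y, f (y + T) = f y) -> f (modT T x) = f x.
Proof. by move=> pf; rewrite /modT -mulrNz periodic_intmul. Qed.

Lemma measurable_modT T : 0 < T -> measurable_fun setT (modT T).
Proof.
move=> T0; apply: measurable_funB => //.
rewrite (_ : (fun x => _) = (fun x => T * (Num.floor (x / T))%:~R)); last first.
  by apply/funext => x; rewrite mulrzr.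
apply: measurable_funM => //; apply: nondecreasing_measurable => // x y xy.
by rewrite ler_int le_floor// ler_wpM2r// invr_ge0 ltW.
Qed.

(** Cut at [c + T], where c is the last multiple of T that is at most a. Moving the right piece back
    by T turns the union into [c, c + T[, a translate of [0, T[ by c. *)
Lemma ge0_integral_periodic_shift g a T : 0 < T -> measurable_fun setT g ->
  (forall x, 0 <= g x)%E -> (forall x, g (x + T) = g x) ->
  (\int[mu]_(x in `[a, (a + T)%R[) g x = \int[mu]_(x in `[0%R, T[) g x)%E.
Proof.
move=> T0 mg g0 pg; set c := T *~ Num.floor (a / T).
have /andP[ca] := modT_itv a T0; rewrite /modT -/c subr_ge0 in ca * => aT.
have {}aT : a <= c + T by rewrite ltrBlDl in aT; exact: ltW.
rewrite (@ge0_integral_itvco_split _ a (c + T))//; last by rewrite lerD2r.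
rewrite -ge0_integral_itvco_translate// addeC.
under eq_integral do rewrite pg.
rewrite -ge0_integral_itvco_split//.
have := @ge0_integral_itvco_translate g 0 T c mg g0.
rewrite add0r [T + c]addrC => <-.
by apply: eq_integral => x _; rewrite periodic_intmul.
Qed.

(* the fibre of [phi] over [y] modulo the period is [psi (y + T *+ k)], [k < N] *)
Lemma ge0_integral_fiber_sum (phi psi p : R -> R) (g : R -> \bar R) T (N : nat) :
  0 < T -> continuous p -> (forall x, 0 <= p x) ->
  (forall x : R, is_derive x (1 : R) phi (p x)) ->
  cancel phi psi -> cancel psi phi -> {mono phi : x y / x <= y} ->
  (forall x, phi (x + T) = phi x + T *+ N) ->
  (forall x, p (x + T) = p x) ->
  measurable_fun setT g -> (forall x, 0 <= g x)%E ->
  (forall x, g (x + T) = g x) ->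
  (\int[mu]_(y in `[0%R, T[) \sum_(k < N) g (psi (y + T *+ k)%R) =
   \int[mu]_(x in `[0%R, T[) (g x * (p x)%:E))%E.
Proof.
move=> T0 cp p0 dphi phiK psiK phi_mono phiT pT mg g0 gT.
have psi_mono : {mono psi : x y / x <= y}.
  by move=> x y; rewrite -phi_mono !psiK.
have mpsi : measurable_fun setT psi.
  by apply: nondecreasing_measurable => // x y; rewrite psi_mono.
have mgp : measurable_fun setT (fun x => (g x * (p x)%:E)%E).
  by apply: emeasurable_funM => //; apply/measurable_EFinP; exact: continuous_measurable_fun.
have gp0 x : (0 <= g x * (p x)%:E)%E by rewrite mule_ge0// lee_fin.
have mgpsi : measurable_fun setT (g \o psi) by exact: measurableT_comp.
rewrite ge0_integral_sum//; last first.
  move=> k; apply: measurable_funTS; apply: measurableT_comp => //.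
  by apply: measurableT_comp => //; exact: measurable_funD.
(* The N translates of [0, T[ by multiples of T tile [0, N T[. *)
transitivity (\int[mu]_(y in `[0%R, (T *+ N)%R[) g (psi y))%E.
  elim: {phiT} N => [|n IH].
    by rewrite big_ord0 mulr0n set_itvco0 integral_set0.
  rewrite big_ord_recr/= IH [RHS](@ge0_integral_itvco_split _ 0 (T *+ n))//.
  - have := @ge0_integral_itvco_translate (g \o psi) 0 T (T *+ n) mgpsi.
    by rewrite add0r -mulrS => /= ->.
  - by rewrite mulrn_wge0// ltW.
  - by rewrite mulrS ler_wpDl// ltW.
rewrite integral_mkcond (@ge0_change_of_variable _ phi psi p cp p0 dphi)//; last first.
- by move=> x; exact: erestrict_ge0.
- by apply/(measurable_restrictT _ _).1 => //; exact: measurable_funTS.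
rewrite -(@ge0_integral_periodic_shift _ (psi 0) T)//; last first.
  by move=> x; rewrite gT pT.
rewrite [RHS]integral_mkcond; apply: eq_integral => x _.
(* One period of x, started at psi 0, is carried by phi onto exactly [0, N T[. *)
have -> : psi 0 + T = psi (T *+ N) by rewrite -[LHS]phiK phiT psiK add0r.
rewrite !patchE !mem_setE !in_itv/= phiK -[0 <= phi x]psi_mono phiK.
rewrite [phi x < _]ltNge -[_ <= phi x]psi_mono phiK -ltNge.
by case: ifP => // _; rewrite mul0e.
Qed.

End periodic_integral.

(** * The unit circle and the angular lift of a Blaschke factor *)

Section circle.
Context {R : realType}.
Local Notation C := (R[i]).
Local Notation Re := complex.Re.
Local Notation Im := complex.Im.
Implicit Types (s t x y : R) (z w a : C).

Lemma complex_ext z w : Re z = Re w -> Im z = Im w -> z = w.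
Proof. by case: z => ? ?; case: w => ? ? /= -> ->. Qed.

Lemma Re_mulc z w : Re (z * w) = Re z * Re w - Im z * Im w.
Proof. by case: z => ? ?; case: w => ? ?. Qed.

Lemma Im_mulc z w : Im (z * w) = Re z * Im w + Im z * Re w.
Proof. by case: z => ? ?; case: w => ? ?. Qed.

Lemma eitD s t : eit (s + t) = eit s * eit t.
Proof.
by apply: complex_ext; rewrite ?Re_mulc ?Im_mulc /= ?cosD ?sinD//; rewrite addrC.
Qed.

Lemma eit0 : eit 0 = 1 :> C.
Proof. by rewrite /eit cos0 sin0. Qed.

Lemma eitN_mul t : eit (- t) * eit t = 1 :> C.
Proof. by rewrite -eitD addNr eit0. Qed.

Lemma eit_neq0 t : eit t != 0 :> C.
Proof.
apply/eqP => e; have := eitN_mul t; rewrite e mulr0 => /eqP.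
by rewrite eq_sym oner_eq0.
Qed.

Lemma eitN t : eit (- t) = (eit t)^-1 :> C.
Proof. by apply: (mulIf (eit_neq0 t)); rewrite eitN_mul mulVf// eit_neq0. Qed.

Lemma conj_eit t : (eit t)^* = eit (- t) :> C.
Proof. by apply: complex_ext => /=; rewrite ?cosN ?sinN. Qed.

Lemma normr_eit t : `|eit t| = 1 :> C.
Proof. by rewrite normc_def /= cos2Dsin2 sqrtr1. Qed.

Lemma eit_2pi t : eit (t + pi *+ 2) = eit t :> C.
Proof. by rewrite /eit cosD2pi sinD2pi. Qed.

Lemma tpi_gt0 : 0 < pi *+ 2 :> R.
Proof. by rewrite pmulrn_lgt0// pi_gt0. Qed.

Lemma eit_inj s t : eit s = eit t :> C -> exists k : int, s = t + (pi *+ 2) *~ k.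
Proof.
move=> st; set T := pi *+ 2; exists (Num.floor ((s - t) / T)).
have /andP[r0 rT] := modT_itv (s - t) tpi_gt0.
have : eit (modT T (s - t)) = 1 :> C.
  rewrite (periodic_modT (f := eit)) ?eitD ?st; last exact: eit_2pi.
  by rewrite mulrC eitN_mul.
move: r0 rT; rewrite -/T; set r := modT T (s - t) => r0 rT [c1 _].
suff : r = 0 by rewrite /r /modT -/T => /eqP; rewrite subr_eq0 => /eqP <-; ring.
apply/eqP; rewrite eq_le r0 andbT leNgt; apply/negP => r1.
(* Half angles: cos r = 1 gives cos^2 (r/2) = 1, hence sin (r/2) = 0, although r/2 lies in ]0, pi[
   where sin is positive. *)
have : cos (r / 2) ^+ 2 = 1.
  move: c1; rewrite -[in cos r](mulfVK (_ : 2 != 0 :> R) r)// mulr_natr.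
  rewrite cos_mulr2n => /eqP; rewrite subr_eq => /eqP h.
  by move: h; set X := _ ^+ 2; lra.
have : 0 < sin (r / 2).
  by apply: sin_gt0_pi; rewrite divr_gt0//= ltr_pdivrMr// mulr_natr.
move=> s0; have := cos2Dsin2 (r / 2) => + h; rewrite h => /eqP.
by rewrite -subr_eq0 addrC addKr sqrf_eq0 gt_eqF.
Qed.

Lemma eit_surj z : `|z| = 1 -> exists t, z = eit t.
Proof.
rewrite normc_def => -[] /eqP; rewrite -[1 in X in X -> _]sqrtr1 eqr_sqrt//; last first.
  by rewrite addr_ge0// sqr_ge0.
move=> /eqP n1.
have rz : -1 <= Re z <= 1.
  by rewrite -ler_norml -(@ler_pXn2r _ 2) ?nnegrE// expr1n real_normK ?num_real// -n1 lerDl sqr_ge0.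
have sE : sin (acos (Re z)) = `|Im z|.
  by rewrite sin_acos// -n1 addrC addKr sqrtr_sqr.
have cE : cos (acos (Re z)) = Re z by rewrite acosK// in_itv.
have [i0|i0] := leP 0 (Im z).
  exists (acos (Re z)); apply: complex_ext => //=.
  by rewrite sE ger0_norm.
exists (- acos (Re z)); apply: complex_ext => /=; rewrite ?cosN ?sinN//.
by rewrite sE ltr0_norm// opprK.
Qed.

Lemma sqr_normC_lt1 a : `|a| < 1 -> Re a ^+ 2 + Im a ^+ 2 < 1.
Proof.
rewrite normc_def ltcE/= eqxx/= => h.
by rewrite ltNge; apply: contraTN h => h; rewrite -leNgt -[leLHS]sqrtr1 ler_wsqrtr.
Qed.

(* The real and imaginary parts of [1 - a * eit (- t)]. *)
Definition qre a t := 1 - Re a * cos t - Im a * sin t.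
Definition qim a t := Re a * sin t - Im a * cos t.
Definition poisson a t :=
  (1 - (Re a ^+ 2 + Im a ^+ 2)) / (qre a t ^+ 2 + qim a t ^+ 2).
(** On the circle a Blaschke factor is a constant times e^{it} q / conj q with q = 1 - a e^{-it},
    hence the doubled argument of q. For |a| < 1 the real part of q is positive, so the arctangent
    is that argument and is smooth, without a branch cut. *)
Definition theta a t := t + 2 * atan (qim a t / qre a t).

Lemma qE a t : 1 - a * eit (- t) = (qre a t +i* qim a t)%C.
Proof.
case: a => x y; apply: complex_ext; rewrite /qre /qim /= ?cosN ?sinN; ring.
Qed.

(** Both sides are |a e^{-it}|^2. *)
Lemma q_cauchy a t :
  (1 - qre a t) ^+ 2 + qim a t ^+ 2 = Re a ^+ 2 + Im a ^+ 2.
Proof.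
have := cos2Dsin2 t; rewrite /qre /qim => h.
transitivity ((Re a ^+ 2 + Im a ^+ 2) * (cos t ^+ 2 + sin t ^+ 2)); first by ring.
by rewrite h mulr1.
Qed.

Lemma qre_gt0 a t : `|a| < 1 -> 0 < qre a t.
Proof.
move=> /sqr_normC_lt1; rewrite -(q_cauchy a t) => h; nra.
Qed.

Lemma qnorm_gt0 a t : `|a| < 1 -> 0 < qre a t ^+ 2 + qim a t ^+ 2.
Proof. by move=> /(qre_gt0 t) h; rewrite ltr_wpDr ?sqr_ge0// exprn_gt0. Qed.

Lemma poisson_gt0 a t : `|a| < 1 -> 0 < poisson a t.
Proof.
by move=> a1; rewrite divr_gt0 ?qnorm_gt0// subr_gt0 sqr_normC_lt1.
Qed.

Lemma is_derive_qre a (t : R) : is_derive t (1 : R) (qre a) (qim a t).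
Proof.
have -> : qre a = (cst 1 : R -> R) - Re a *: (@cos R : R -> R)
   - Im a *: (@sin R : R -> R) by apply/funext.
apply: is_derive_eq; rewrite /qim sub0r /GRing.scale/=; ring.
Qed.

Lemma is_derive_qim a (t : R) : is_derive t (1 : R) (qim a) (1 - qre a t).
Proof.
have -> : qim a = Re a *: (@sin R : R -> R) - Im a *: (@cos R : R -> R).
  by apply/funext.
apply: is_derive_eq; rewrite /qre /GRing.scale/=; ring.
Qed.

Lemma is_derive_theta a (t : R) : `|a| < 1 ->
  is_derive t (1 : R) (theta a) (poisson a t).
Proof.
move=> a1; have q0 : qre a t != 0 by rewrite gt_eqF// qre_gt0.
have d1 := is_derive_qre a t; have d2 := is_derive_qim a t.
have dV := is_deriveV q0 d1.
have dM := is_deriveM d2 dV.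
have dA := is_derive1_comp (is_derive1_atan _) dM.
have -> : theta a = id + 2 *: (atan \o (qim a * (fun t => (qre a t)^-1))).
  by apply/funext.
have dZ := is_deriveZ 2 dA.
apply: (is_derive_eq (is_deriveD (is_derive_id _ _) dZ)).
rewrite /poisson -(q_cauchy a t) [(qim a * _) t](_ : _ = qim a t / qre a t)// /GRing.scale/=.
have n0 : qre a t ^+ 2 + qim a t ^+ 2 != 0 by rewrite gt_eqF// qnorm_gt0.
by field; rewrite q0/= n0.
Qed.

Lemma theta_2pi a t : theta a (t + pi *+ 2) = theta a t + pi *+ 2.
Proof. by rewrite /theta /qre /qim !sinD2pi !cosD2pi; ring. Qed.

Lemma theta_bound a t : `|theta a t - t| <= pi.
Proof.
rewrite /theta addrC addKr ler_norml.
have := atan_ltpi2 (qim a t / qre a t); have := atan_gtNpi2 (qim a t / qre a t).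
set u := atan _; lra.
Qed.

Lemma continuous_poisson a : `|a| < 1 -> continuous (poisson a).
Proof.
move=> a1 t; apply: cvgM; first exact: cvg_cst.
have cq : {for t, continuous (qre a)}.
  by apply/differentiable_continuous/derivable1_diffP; case: (is_derive_qre a t).
have ci : {for t, continuous (qim a)}.
  by apply/differentiable_continuous/derivable1_diffP; case: (is_derive_qim a t).
apply: cvgV; first by rewrite gt_eqF// qnorm_gt0.
by apply: cvgD; apply: cvgM.
Qed.

Lemma poisson_2pi a t : poisson a (t + pi *+ 2) = poisson a t.
Proof. by rewrite /poisson /qre /qim !sinD2pi !cosD2pi. Qed.

(** Only the argument of u + iv matters: in q / conj q the nonzero real factor k cancels. *)
Lemma eit_atan_ratio (u v : R) : 0 < u ->
  exists2 k : R, k != 0 & (u +i* v)%C = k%:C%C * eit (atan (v / u)).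
Proof.
move=> u0; set al := atan _.
have c0 : cos al != 0.
  by rewrite gt_eqF// cos_gt0_pihalf// atan_gtNpi2 atan_ltpi2.
exists (u / cos al); first by rewrite mulf_neq0 ?invr_eq0// gt_eqF.
have tE : sin al = v / u * cos al by rewrite -[v / u]atanK -/al /tan mulfVK.
by apply: complex_ext; rewrite ?Re_mulc ?Im_mulc /= ?tE; field; rewrite c0 ?gt_eqF.
Qed.

Lemma eit_theta a t : `|a| < 1 ->
  eit (theta a t) = eit t * ((1 - a * eit (- t)) / (1 - a * eit (- t))^*).
Proof.
move=> a1; have [k k0 e] := eit_atan_ratio (qim a t) (qre_gt0 t a1).
rewrite qE e /theta; set al := atan _.
have kC : k%:C%C != 0 :> C by apply/eqP => -[] /eqP; rewrite (negbTE k0).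
rewrite rmorphM/= conj_eit.
have -> : (k%:C%C)^* = k%:C%C :> C by apply: complex_ext => //=; rewrite oppr0.
rewrite mulrDl mul1r 2!eitD eitN; field.
by rewrite eit_neq0; exact: kC.
Qed.

Lemma one_sub_conjM_eit a t : 1 - a^* * eit t = (1 - a * eit (- t))^*.
Proof. by rewrite rmorphB rmorph1 rmorphM/= conj_eit opprK. Qed.

Lemma q_neq0 a t : `|a| < 1 -> 1 - a * eit (- t) != 0.
Proof.
move=> a1; rewrite qE; apply/eqP => -[] /eqP.
by rewrite gt_eqF// qre_gt0.
Qed.

Lemma bfactor_eit a : `|a| < 1 ->
  exists c, forall t, bfactor a (eit t) = eit (c + theta a t).
Proof.
move=> a1; have [a0|a0] := eqVneq a 0.
  exists 0 => t; rewrite add0r eit_theta// /bfactor a0 eqxx !mul0r subr0.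
  by rewrite rmorph1 divr1 mulr1.
have [c cE] : exists c, - (`|a| / a) = eit c.
  by apply: eit_surj; rewrite normrN normf_div normr_id divff// normr_eq0.
exists c => t; rewrite eitD eit_theta// -cE /bfactor (negbTE a0).
rewrite one_sub_conjM_eit.
have -> : a - eit t = - (eit t * (1 - a * eit (- t))).
  by rewrite eitN; field; rewrite eit_neq0.
by rewrite !mulNr mulrN -!mulrA.
Qed.

End circle.

(** * The lift of the Blaschke product and the fibres of b *)

Section blaschke_lift.
Context {R : realType}.
Local Notation C := (R[i]).
Local Notation Re := complex.Re.
Local Notation Im := complex.Im.
Variables (N : nat) (alpha : 'I_N -> C).
Hypotheses (N0 : (0 < N)%N) (alpha_lt1 : forall j, `|alpha j| < 1).
Implicit Types (s t y : R) (z w : C).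

(* [N * J_0] on the circle *)
Definition NJ t : R := \sum_(j < N) poisson (alpha j) t.

Lemma NJ_gt0 t : 0 < NJ t.
Proof.
rewrite /NJ; case: N N0 alpha alpha_lt1 => // n _ a a1.
rewrite big_ord_recl ltr_pwDl ?poisson_gt0// sumr_ge0// => i _.
by rewrite ltW// poisson_gt0.
Qed.

Lemma continuous_NJ : continuous NJ.
Proof.
rewrite (_ : NJ = \sum_(j < N) poisson (alpha j)); last first.
  by apply/funext => t; rewrite fct_sumE.
elim/big_ind: _ => [|f g cf cg|j _]; last exact: continuous_poisson.
- by move=> t; exact: cvg_cst.
- by move=> t; apply: cvgD; [exact: cf|exact: cg].
Qed.

Lemma NJ_2pi t : NJ (t + pi *+ 2) = NJ t.
Proof. by apply: eq_bigr => j _; exact: poisson_2pi. Qed.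

Lemma blaschke_lift_exists : exists phi : R -> R,
  [/\ forall t, blaschke alpha (eit t) = eit (phi t),
      forall t : R, is_derive t (1 : R) phi (NJ t),
      forall t, phi (t + pi *+ 2) = phi t + (pi *+ 2) *+ N &
      exists M, forall t, `|phi t - N%:R * t| <= M].
Proof.
have [c cE] := choice (fun j => bfactor_eit (alpha_lt1 j)).
exists (fun t => \sum_(j < N) (c j + theta (alpha j) t)); split.
- move=> t; rewrite /blaschke; under eq_bigr do rewrite cE.
  by apply: (big_ind2 (fun z s => z = eit s)); rewrite ?eit0// => z s w u -> ->; rewrite eitD.
- move=> t.
  have -> : (fun t => \sum_(j < N) (c j + theta (alpha j) t)) =
     \sum_(j < N) (cst (c j) + theta (alpha j)) :> (R -> R).
    by apply/funext => u; rewrite fct_sumE.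
  have d j : is_derive t (1 : R) (cst (c j) + theta (alpha j)) (0 + poisson (alpha j) t).
    by apply: is_deriveD; exact: is_derive_theta.
  apply: (is_derive_eq (is_derive_sum _)).
  by apply: eq_bigr => j _; rewrite add0r.
- move=> t; under eq_bigr do rewrite theta_2pi addrA.
  by rewrite big_split/= sumr_const card_ord.
- exists (\sum_(j < N) (`|c j| + pi)) => t.
  have -> : N%:R * t = \sum_(j < N) t by rewrite sumr_const card_ord mulr_natl.
  rewrite -sumrB (le_trans (ler_norm_sum _ _ _))// ler_sum// => j _.
  by rewrite -addrA (le_trans (ler_normD _ _))// lerD2l theta_bound.
Qed.

Lemma blaschke_lift : exists phi psi : R -> R,
  [/\ forall t, blaschke alpha (eit t) = eit (phi t),
      forall t : R, is_derive t (1 : R) phi (NJ t),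
      cancel phi psi /\ cancel psi phi,
      {mono phi : x y / x <= y} &
      forall t, phi (t + pi *+ 2) = phi t + (pi *+ 2) *+ N].
Proof.
have [phi [bE dphi phiT [M phiM]]] := blaschke_lift_exists.
have cphi : continuous phi.
  by move=> x; apply/differentiable_continuous/derivable1_diffP; case: (dphi x).
have phi_lt : {homo phi : x y / x < y}.
  move=> x y xy; have [c _] := MVT xy (fun u _ => dphi u) (continuous_subspaceT cphi).
  by move=> e; rewrite -subr_gt0 e mulr_gt0 ?subr_gt0 ?NJ_gt0.
have phi_mono := le_mono phi_lt.
have Nr0 : 0 < N%:R :> R by rewrite ltr0n.
have phi_surj y : exists x, phi x = y.
  have M0 : 0 <= M by exact: le_trans (normr_ge0 _) (phiM 0).
  (* Since phi stays within M of N t, its values at these two points bracket y. *)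
  pose a := (y - M) / N%:R; pose b := (y + M) / N%:R.
  have ab : a <= b by rewrite ler_pM2r ?invr_gt0//; lra.
  have Na : N%:R * a = y - M by rewrite mulrC divfK// gt_eqF.
  have Nb : N%:R * b = y + M by rewrite mulrC divfK// gt_eqF.
  have := phiM a; rewrite Na ler_distl => /andP[_ ha].
  have := phiM b; rewrite Nb ler_distl => /andP[hb _].
  have [|c _ cy] := @IVT _ phi a b y ab (continuous_subspaceT cphi).
    by rewrite ge_min le_max; apply/andP; split; apply/orP; [left|right]; lra.
  by exists c.
have [psi psiK] := choice phi_surj.
exists phi, psi; split => //; split=> //.
by move=> x; apply: (inc_inj phi_mono); rewrite psiK.
Qed.

Lemma bfactor_norm a z : `|a| < 1 -> 1 - a^* * z != 0 ->
  `|bfactor a z| ^+ 2 * `|1 - a^* * z| ^+ 2 = `|a - z| ^+ 2.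
Proof.
move=> a1 q0; rewrite /bfactor; case: eqVneq => [->|a0].
  by rewrite rmorph0 mul0r subr0 sub0r normrN normr1 expr1n mulr1.
rewrite -exprMn -normrM -[X in `|X|]mulrA divfK// normrM normf_div normr_id divff ?normr_eq0//.
by rewrite mul1r.
Qed.

(** For |a| < 1 the right-hand side has the sign of 1 - |z|^2, which decides whether a Blaschke
    factor is smaller or larger than 1 in modulus. *)
Lemma moebius_identity a z :
  `|1 - a^* * z| ^+ 2 - `|a - z| ^+ 2 = (1 - `|a| ^+ 2) * (1 - `|z| ^+ 2).
Proof.
rewrite !normCK !rmorphB rmorph1 rmorphM/= conjCK; ring.
Qed.

Lemma bfactor_norm_lt1 a z : `|a| < 1 -> `|z| < 1 -> `|bfactor a z| < 1.
Proof.
move=> a1 z1; have [q0|q0] := eqVneq (1 - a^* * z) 0.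
  rewrite /bfactor; case: eqVneq => // _.
  by rewrite q0 invr0 !mulr0 normr0.
rewrite -(@ltr_pXn2r _ 2) ?nnegrE// expr1n.
have q2 : 0 < `|1 - a^* * z| ^+ 2 by rewrite exprn_gt0// normr_gt0.
rewrite -(ltr_pM2r q2) bfactor_norm// mul1r -subr_gt0 moebius_identity.
by rewrite mulr_gt0// subr_gt0 exprn_ilt1.
Qed.

(** At the pole z = 1 / conj a, division by zero gives the value 0 instead of infinity. The
    exception is harmless for the fibres: a vanishing factor makes the product 0, which is not of
    modulus 1. *)
Lemma bfactor_norm_gt1 a z : `|a| < 1 -> 1 < `|z| ->
  bfactor a z = 0 \/ 1 < `|bfactor a z|.
Proof.
move=> a1 z1; have [q0|q0] := eqVneq (1 - a^* * z) 0.
  move: q0; rewrite /bfactor; case: eqVneq => [-> _|_ ->]; first by right.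
  by left; rewrite invr0 !mulr0.
right; rewrite -(@ltr_pXn2r _ 2) ?nnegrE// expr1n.
have q2 : 0 < `|1 - a^* * z| ^+ 2 by rewrite exprn_gt0// normr_gt0.
rewrite -(ltr_pM2r q2) bfactor_norm// mul1r -subr_lt0 moebius_identity.
by rewrite nmulr_llt0 ?subr_gt0 ?exprn_ilt1// subr_lt0 exprn_egt1.
Qed.

(** Confines the sum in [transfer], which ranges over all complex solutions, to the circle, where
    the lift describes it. *)
Lemma blaschke_fiber_circle z : `|blaschke alpha z| = 1 -> `|z| = 1.
Proof.
rewrite /blaschke normr_prod => b1.
have [z1|z1|//] := real_ltgtP (normr_real z) (@real1 C).
- suff : \prod_(j < N) `|bfactor (alpha j) z| < 1 by rewrite b1 ltxx.
  case: N N0 alpha alpha_lt1 {b1} => // n _ a a1.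
  rewrite big_ord_recl (le_lt_trans _ (bfactor_norm_lt1 (a1 ord0) z1))//.
  rewrite ler_piMr//.
  suff /andP[] : 0 <= \prod_(i < n) `|bfactor (a (lift ord0 i)) z| <= 1 by [].
  elim/big_ind: _ => [|x y /andP[x0 x1] /andP[y0 y1]|j _].
  - by rewrite ler01 lexx.
  - by rewrite mulr_ge0// mulr_ile1.
  - by rewrite normr_ge0 ltW// bfactor_norm_lt1.
- have [[j /eqP bj]|bz] := pselect (exists j, bfactor (alpha j) z == 0).
    by move: b1; rewrite (bigD1 j)//= bj normr0 mul0r => /eqP; rewrite eq_sym oner_eq0.
  have bz1 j : 1 < `|bfactor (alpha j) z|.
    have [bj|//] := bfactor_norm_gt1 (alpha_lt1 j) z1.
    by exfalso; apply: bz; exists j; rewrite bj.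
  suff : 1 < \prod_(j < N) `|bfactor (alpha j) z| by rewrite b1 ltxx.
  case: N N0 alpha alpha_lt1 {b1 bz} bz1 => // n _ a a1 bz1.
  rewrite big_ord_recl (lt_le_trans (bz1 ord0))//.
  rewrite ler_peMr//; elim/big_ind: _ => //; first by move=> x y; exact: mulr_ege1.
  by move=> j _; rewrite ltW.
Qed.

Lemma transfer_eit (phi psi : R -> R) (xi : C -> C) y :
  (forall t, blaschke alpha (eit t) = eit (phi t)) ->
  cancel phi psi -> cancel psi phi ->
  (forall t, phi (t + pi *+ 2) = phi t + (pi *+ 2) *+ N) ->
  transfer alpha xi (eit y) =
  N%:R^-1 * \sum_(k < N) xi (eit (psi (y + (pi *+ 2) *+ k))).
Proof.
move=> bE phiK psiK phiT.
pose f (k : 'I_N) : C := eit (psi (y + (pi *+ 2) *+ k)).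
have phiZ (m : int) t : phi (t + (pi *+ 2) *~ m) = phi t + (pi *+ 2) *+ N *~ m.
  have phiN n u : phi (u + (pi *+ 2) *+ n) = phi u + (pi *+ 2) *+ N *+ n.
    elim: n => [|n IH]; first by rewrite !mulr0n !addr0.
    by rewrite (mulrSr (pi *+ 2)) addrA phiT IH (mulrSr _ n) addrA.
  case: m => n; first exact: phiN.
  rewrite NegzE !mulrNz -!pmulrn; have := phiN n.+1 (t - (pi *+ 2) *+ n.+1).
  by rewrite subrK => ->; rewrite addrK.
congr (_ * _); rewrite /transfer.
rewrite (_ : [set w | _] = [set f k | k in [set: 'I_N]]); last first.
  apply/seteqP; split => w /=.
    move=> bw; have /eit_surj [s ws] : `|w| = 1.
      by apply: blaschke_fiber_circle; rewrite bw normr_eit.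
    move: bw; rewrite ws bE => /eit_inj [m mE].
    have Nz : N%:Z != 0 by rewrite -lt0n.
    (* Divide the number m of turns of phi by N: the quotient counts full turns of s, invisible to
       [eit], and the remainder is the index in the fibre. *)
    pose q := (m %/ N)%Z; pose k := `|(m %% N)%Z|%N.
    have kE : (k : int) = (m %% N)%Z by rewrite gez0_abs// modz_ge0.
    have kN : (k < N)%N by rewrite -ltz_nat kE ltz_pmod.
    exists (Ordinal kN) => //=.
    have : s - (pi *+ 2) *~ q = psi (y + (pi *+ 2) *+ k).
      rewrite -[LHS]phiK -mulrNz phiZ mE; congr (psi _).
      rewrite {1}(divz_eq m N) -/q -kE.
      by rewrite mulrNz mulrzDr [q * _]mulrC mulrzA -!pmulrn addrA addrAC addrK.
    rewrite /f /= => <-.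
    by rewrite -mulrNz (periodic_intmul (f := eit)) //; exact: eit_2pi.
  by move=> [k _ <-]; rewrite /f bE psiK (periodic_natmul (f := eit)) //; exact: eit_2pi.
rewrite fsbig_image.
  rewrite (_ : [set: 'I_N] = [set` enum 'I_N]).
    by rewrite -fsbig_seq ?enum_uniq// big_enum; apply: eq_bigl.
  by apply/seteqP; split=> k //= _; rewrite mem_enum.
(* Injectivity of the indexing: two indices giving the same point are congruent modulo N, and both
   are below N. *)
move=> k l _ _ /eit_inj [m] /(congr1 phi); rewrite phiZ !psiK => e.
have {}e : (pi *+ 2) *~ Posz k = (pi *+ 2) *~ (Posz l + m * Posz N) :> R.
  by apply: (addrI y); rewrite e mulrzDr -!pmulrn [m * N]mulrC mulrzA -pmulrn addrA.
have T0 : pi *+ 2 != 0 :> R by rewrite gt_eqF// tpi_gt0.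
have {e} kl : Posz k = Posz l + m * Posz N.
  apply: (@intr_inj R); apply: (mulfI T0).
  by rewrite !mulrzr.
have modk (i : 'I_N) : (Posz i %% Posz N)%Z = Posz i.
  by apply: modz_small; rewrite ltz_nat ltn_ord.
apply/val_inj; suff : Posz k = Posz l by case.
by rewrite -modk kl addrC modzMDl modk.
Qed.

End blaschke_lift.

(** * Complex derivatives and the values of J_0 on the circle *)

Section numfield_derivative.
Variable K : numFieldType.
Implicit Types (f g : K -> K) (z d : K).

(* Unlike [K], the type [R[i]] carries no canonical topology; the derivative
   over [R[i]] is reached through this definition. *)
Definition field_derivative f z d : Prop := is_derive z (1 : K) f d.

Lemma is_derive_epsilon f z d : field_derivative f z d ->
  forall e : K, 0 < e -> exists2 del : K, 0 < del &
    forall h : K, 0 < `|h| -> `|h| < del -> `|(f (z + h) - f z) / h - d| < e.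
Proof.
move=> [df dE] e e0.
have : (fun h => h^-1 *: ((f \o shift z) (h *: (1 : K)) - f z)) @ 0^' --> d.
  by rewrite -dE; exact: df.
move/cvgrPdist_lt => /(_ e e0) [del /= del0 H]; exists del => // h h0 hdel.
have := H h; rewrite /= sub0r normrN => /(_ hdel).
rewrite normr_gt0 in h0; move=> /(_ h0).
by rewrite distrC /GRing.scale/= mulr1 [h + z]addrC mulrC.
Qed.

Lemma is_deriveV_numField f z d : f z != 0 -> is_derive z (1 : K) f d ->
  is_derive z (1 : K) (fun w => (f w)^-1) (- (f z) ^- 2 *: d).
Proof.
move=> f0 [df dE]; apply: DeriveDef; first exact: derivableV.
by rewrite deriveV// dE.
Qed.

(** In logarithmic form the derivative of a product becomes a sum over the factors, as needed for z
    b' / b. *)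
Lemma is_derive_logprod n (f : 'I_n -> K -> K) (d : 'I_n -> K) z :
  (forall j, field_derivative (f j) z (d j)) -> (forall j, f j z != 0) ->
  field_derivative (fun w => \prod_(j < n) f j w)
    z ((\prod_(j < n) f j z) * \sum_(j < n) d j / f j z).
Proof.
elim: n f d => [|n IH] f d df f0.
  rewrite (_ : (fun w => _) = cst 1); last by apply/funext => w; rewrite big_ord0.
  by apply: is_derive_eq; rewrite !big_ord0 mulr0.
have {IH} := IH (fun j => f (lift ord0 j)) (fun j => d (lift ord0 j))
  (fun j => df _) (fun j => f0 _).
move/(is_deriveM (df ord0)) => H.
rewrite (_ : (fun w => _) = f ord0 * (fun w => \prod_(j < n) f (lift ord0 j) w)).
  apply: (is_derive_eq H); rewrite !big_ord_recl /GRing.scale/=.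
  by have := f0 ord0; set q := \sum_(i < n) _; set p := \prod_(i < n) _ => f00; field.
by apply/funext => w; rewrite big_ord_recl.
Qed.

Lemma is_derive_moebius (k a c z : K) : 1 - c * z != 0 ->
  field_derivative (fun w => k * ((a - w) / (1 - c * w))) z
    (k * ((c * a - 1) / (1 - c * z) ^+ 2)).
Proof.
move=> q0.
have d1 : is_derive z (1 : K) (cst a - id : K -> K) (0 - 1).
  exact: is_deriveB.
have d2 : is_derive z (1 : K) (cst 1 - c *: id : K -> K) (0 - c *: 1).
  exact: is_deriveB.
have q0' : (cst 1 - c *: id : K -> K) z != 0 by [].
have H := is_deriveZ k (is_deriveM d1 (is_deriveV_numField q0' d2)).
apply: (is_derive_eq H).
rewrite [(cst a - id) z](_ : _ = a - z)// [(cst 1 - c *: id) z](_ : _ = 1 - c * z)//.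
by rewrite /GRing.scale/=; field.
Qed.

End numfield_derivative.

Section blaschke_derivative.
Context {R : realType}.
Local Notation C := (R[i]).

Lemma normC_real (z : C) : exists2 r : R, 0 <= r & `|z| = r%:C%C.
Proof. by exists (Num.sqrt (complex.Re z ^+ 2 + complex.Im z ^+ 2)); rewrite ?sqrtr_ge0// normc_def. Qed.

(** [cderiv] selects some derivative by choice, so its value can be computed only through
    uniqueness. *)
Lemma is_cderiv_unique (f : C -> C) z d1 d2 :
  is_cderiv f z d1 -> is_cderiv f z d2 -> d1 = d2.
Proof.
move=> h1 h2; apply/eqP; rewrite -subr_eq0 -normr_eq0.
have [r r0 rE] := normC_real (d1 - d2); rewrite rE.
apply/eqP; congr (_%:C%C); apply/eqP; rewrite eq_le r0 andbT leNgt.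
apply/negP => {}r0; have r2 : 0 < r / 2 by rewrite divr_gt0.
have [e1 e10 H1] := h1 _ r2; have [e2 e20 H2] := h2 _ r2.
(* A real increment admissible for both limits at once. *)
pose e := Num.min e1 e2 / 2.
have e0 : 0 < e by rewrite divr_gt0// lt_min e10.
have eN : `|e%:C%C| = e%:C%C :> C by rewrite ger0_norm// ler0c ltW.
have e_lt x : Num.min e1 e2 <= x -> e < x.
  by move=> h; apply: lt_le_trans h; rewrite /e ltr_pdivrMr// ltr_pMr ?lt_min ?e10// ltr1n.
have := H1 e%:C%C; have := H2 e%:C%C; rewrite eN ltcR => /(_ e0) + /(_ e0).
rewrite !ltcR; have -> : e < e1 by apply: e_lt; rewrite ge_min lexx.
have -> : e < e2 by apply: e_lt; rewrite ge_min lexx orbT.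
move=> /(_ isT) a2 /(_ isT) a1.
have := ltrD a1 a2; rewrite ltNge => /negP; apply.
have : `|d1 - d2| <= `|(f (z + e%:C%C) - f z) / e%:C%C - d1| +
    `|(f (z + e%:C%C) - f z) / e%:C%C - d2|.
  by rewrite -[X in _ <= X + _]normrN (le_trans _ (ler_normD _ _))// opprB addrA subrK.
by rewrite rE lecE -splitr => /andP[].
Qed.

Lemma is_derive_is_cderiv (f : C -> C) z d :
  field_derivative f z d -> is_cderiv f z d.
Proof.
move=> /is_derive_epsilon H e e0.
have [|del del0 Hd] := H e%:C%C; first by rewrite ltcR.
have delE : del = (complex.Re del)%:C%C.
  by rewrite RRe_real// gtr0_real.
exists (complex.Re del); first by rewrite -ltcR -delE.
by move=> h h0; rewrite -delE; exact: Hd.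
Qed.

Variables (N : nat) (alpha : 'I_N -> C).
Hypotheses (N0 : (0 < N)%N) (alpha_lt1 : forall j, `|alpha j| < 1).

Lemma bfactor_eit_neq0 (a : C) t : `|a| < 1 -> bfactor a (eit t) != 0.
Proof. by move=> /bfactor_eit [c ->]; exact: eit_neq0. Qed.

Lemma poissonE (a : C) t : (poisson a t)%:C%C =
  (1 - `|a| ^+ 2) / ((1 - a * eit (- t)) * (1 - a * eit (- t))^*).
Proof.
rewrite -sqr_normc -!add_Re2_Im2 qE /= /poisson.
by rewrite rmorphM rmorphB rmorph1 fmorphV.
Qed.

(** For a Blaschke factor f, z f' / f reduces to (1 - |a|^2) / |1 - conj a z|^2 once z conj z = 1.
    This makes [J0] real and positive on the circle, so that [ln (Re J0)] is its genuine
    logarithm. *)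
Lemma is_cderiv_bfactor (a : C) t : `|a| < 1 ->
  exists d, field_derivative (bfactor a) (eit t) d /\
    eit t * (d / bfactor a (eit t)) = (poisson a t)%:C%C.
Proof.
move=> a1; have z0 := eit_neq0 t; rewrite poissonE.
have [->|a0] := eqVneq a 0.
  exists 1; split; last first.
    by rewrite /bfactor eqxx mul1r divff// !mul0r !subr0 normr0 rmorph1 expr0n subr0 mulr1 divr1.
  by rewrite (_ : bfactor 0 = id); [exact: is_derive_id|apply/funext => w; rewrite /bfactor eqxx].
have q0 : 1 - a^* * eit t != 0 by rewrite one_sub_conjM_eit conjC_eq0 q_neq0.
have H := is_derive_moebius (`|a| / a) a q0.
exists (`|a| / a * ((a^* * a - 1) / (1 - a^* * eit t) ^+ 2)); split.
  by rewrite (_ : bfactor a = (fun w => `|a| / a * ((a - w) / (1 - a^* * w))))//;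
    apply/funext => w; rewrite /bfactor (negbTE a0).
rewrite -one_sub_conjM_eit sqr_normc.
have n0 : `|a| != 0 by rewrite normr_eq0.
have q1 := q_neq0 t a1; rewrite eitN in q1 *.
have s0 : eit t - a != 0.
  apply: contraNneq q1 => /eqP; rewrite subr_eq0 => /eqP <-.
  by rewrite divff// subrr.
rewrite /bfactor (negbTE a0).
have s1 : a - eit t != 0 by rewrite -oppr_eq0 opprB.
field.
by rewrite z0 q0 s0 s1 n0 a0.
Qed.

Lemma J0_eit t : J0 alpha (eit t) = (NJ alpha t / N%:R)%:C%C.
Proof.
have [d dE] := choice (fun j => is_cderiv_bfactor t (alpha_lt1 j)).
have b0 j := bfactor_eit_neq0 t (alpha_lt1 j).
have bn0 : blaschke alpha (eit t) != 0 by apply/prodf_neq0 => j _; exact: b0.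
have /is_derive_is_cderiv H := is_derive_logprod (fun j => (dE j).1) b0.
have cdE : cderiv (blaschke alpha) (eit t) =
    blaschke alpha (eit t) * \sum_(j < N) d j / bfactor (alpha j) (eit t).
  by rewrite /cderiv; case: xgetP => [y _ Hy|/(_ _ H)//]; exact: is_cderiv_unique Hy H.
rewrite /J0 cdE /NJ rmorphM fmorphV rmorph_nat rmorph_sum.
have -> : \sum_(j < N) (poisson (alpha j) t)%:C%C =
    eit t * \sum_(j < N) d j / bfactor (alpha j) (eit t).
  by rewrite mulr_sumr; apply: eq_bigr => j _; rewrite (dE j).2.
set S := \sum_(j < N) _.
have Nn0 : N%:R != 0 :> C by rewrite pnatr_eq0 -lt0n.
by rewrite mulrCA [N%:R * _]mulrC -mulf_div divff// mul1r.
Qed.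

End blaschke_derivative.

(** * The Herglotz kernel and Lipschitz bounds in the chord metric *)

Section herglotz.
Context {R : realType}.
Local Notation C := (R[i]).
Local Notation mu := (@lebesgue_measure R).
Local Notation dom := (@dom R).
Local Notation Re := complex.Re.
Local Notation Im := complex.Im.
Implicit Types (s t r : R) (a z : C).

(** Zeros of f are allowed, since the power -1 and the inverse both vanish at 0. The kernels need
    this when a lies on the circle. *)
Lemma measurable_invr_ge0 d (T : measurableType d) (D : set T) (f : T -> R) :
  measurable_fun D f -> (forall x, 0 <= f x) -> measurable_fun D (fun x => (f x)^-1).
Proof.
move=> mf f0; rewrite (_ : (fun x => _) = (fun x => f x `^ (-1))).
  by apply: (measurableT_comp (measurable_powR (-1)) mf).
by apply/funext => x; rewrite powR_inv1.
Qed.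

Lemma compact_dom : compact dom.
Proof. exact: segment_compact. Qed.

Lemma measurable_dom : measurable dom.
Proof. exact: measurable_itv. Qed.

Lemma continuous_integrable_dom (f : R -> R) : continuous f ->
  mu.-integrable dom (EFin \o f).
Proof.
move=> cf; apply: continuous_compact_integrable; first exact: compact_dom.
exact: continuous_subspaceT.
Qed.

Lemma dom_modT t : dom (modT (pi *+ 2) t).
Proof.
by rewrite /dom /= in_itv/=; have /andP[-> /ltW ->] := modT_itv t (@tpi_gt0 R).
Qed.

Lemma continuous_periodic_min (f : R -> R) : continuous f ->
  (forall t, f (t + pi *+ 2) = f t) -> (forall t, 0 < f t) ->
  exists2 m, 0 < m & forall t, m <= f t.
Proof.
move=> cf pf f0.
have [c _ cm] := EVT_min (ltW (@tpi_gt0 R)) (continuous_subspaceT cf).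
exists (f c) => // t; rewrite -(periodic_modT t pf); apply: cm.
exact: dom_modT.
Qed.

Lemma continuous_periodic_max (f : R -> R) : continuous f ->
  (forall t, f (t + pi *+ 2) = f t) ->
  exists2 M, 0 < M & forall t, `|f t| <= M.
Proof.
move=> cf pf.
have cnf : continuous (fun t => `|f t|).
  by move=> t; apply: cvg_norm; exact: cf.
have [c _ cm] := EVT_max (ltW (@tpi_gt0 R)) (continuous_subspaceT cnf).
exists (`|f c| + 1); first by rewrite ltr_wpDl.
move=> t; rewrite -(periodic_modT t pf); apply: (le_trans (cm _ (dom_modT t))).
by rewrite lerDl.
Qed.

Definition qnorm a s := qre a s ^+ 2 + qim a s ^+ 2.
(** The conjugate Poisson kernel: the imaginary part of (e^{is} + a) / (e^{is} - a). *)
Definition cpoisson a s := - 2 * qim a s / qnorm a s.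

Lemma herglotz_kernelE a s : `|a| < 1 ->
  (eit s + a) / (eit s - a) = (poisson a s +i* cpoisson a s)%C.
Proof.
move=> a1; have q0 := q_neq0 s a1.
have -> : (eit s + a) / (eit s - a) = 2 / (1 - a * eit (- s)) - 1.
  have z0 := @eit_neq0 R s.
  have s0 : eit s - a != 0.
    apply: contraNneq q0 => /eqP; rewrite subr_eq0 => /eqP <-.
    by rewrite -eitD subrr eit0 subrr.
  by rewrite eitN; field; rewrite z0 s0.
have D0 : qnorm a s != 0 by rewrite gt_eqF// qnorm_gt0.
rewrite qE /poisson -(q_cauchy a s); rewrite /cpoisson /qnorm in D0 *.
by apply/eqP; rewrite eq_complex /=; apply/andP; split; apply/eqP; field.
Qed.

Lemma is_derive_cpoisson a (s : R) : `|a| < 1 ->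
  is_derive s (1 : R) (fun s => - ln (qnorm a s)) (cpoisson a s).
Proof.
move=> a1; have q0 := qnorm_gt0 s a1; rewrite -/(qnorm a s) in q0.
have d1 := is_derive_qre a s; have d2 := is_derive_qim a s.
have dq : is_derive s (1 : R) (qnorm a) (2 * qim a s).
  rewrite (_ : qnorm a = qre a ^+ 2 + qim a ^+ 2); last by apply/funext.
  apply: is_derive_eq; rewrite /GRing.scale/= !expr1; ring.
have dl := is_derive1_comp (is_derive1_ln q0) dq.
have -> : (fun s => - ln (qnorm a s)) = - (@ln R \o qnorm a) by apply/funext.
by apply: (is_derive_eq (is_deriveN dl)); rewrite /cpoisson; ring.
Qed.

Lemma continuous_qre a : continuous (qre a).
Proof.
by move=> x; apply/differentiable_continuous/derivable1_diffP; case: (is_derive_qre a x).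
Qed.

Lemma continuous_qim a : continuous (qim a).
Proof.
by move=> x; apply/differentiable_continuous/derivable1_diffP; case: (is_derive_qim a x).
Qed.

Lemma continuous_cpoisson a : `|a| < 1 -> continuous (cpoisson a).
Proof.
move=> a1 x; apply: cvgM; first by apply: cvgM; [exact: cvg_cst|exact: continuous_qim].
apply: cvgV; first by rewrite gt_eqF// qnorm_gt0.
by apply: cvgD; apply: cvgM; (exact: continuous_qre || exact: continuous_qim).
Qed.

Lemma Rintegral_derivative (F f : R -> R) : continuous f ->
  (forall s : R, is_derive s (1 : R) F (f s)) ->
  integT f = F (pi *+ 2) - F 0.
Proof.
move=> cf dF.
have cF : continuous F.
  by move=> x; apply/differentiable_continuous/derivable1_diffP; case: (dF x).
rewrite /integT /Rintegral (@continuous_FTC2 _ _ F) ?tpi_gt0//.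
- exact: continuous_subspaceT.
- split; first by move=> x _; case: (dF x).
  + exact/cvg_at_right_filter/cF.
  + exact/cvg_at_left_filter/cF.
- by move=> x _; rewrite derive1E; case: (dF x).
Qed.

(** The angle [theta] is a primitive of the kernel and grows by 2 pi in one turn. *)
Lemma integT_poisson a : `|a| < 1 -> integT (poisson a) = pi *+ 2.
Proof.
move=> a1.
rewrite (Rintegral_derivative (continuous_poisson a1) (fun s => is_derive_theta s a1)).
by have := theta_2pi a 0; rewrite add0r => ->; rewrite addrC addKr.
Qed.

(** The primitive -ln |1 - a e^{-is}|^2 is periodic. *)
Lemma integT_cpoisson a : `|a| < 1 -> integT (cpoisson a) = 0.
Proof.
move=> a1.
rewrite (Rintegral_derivative (continuous_cpoisson a1) (fun s => is_derive_cpoisson s a1)).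
by rewrite /qnorm /qre /qim cos2pi sin2pi cos0 sin0 subrr.
Qed.

Definition chord2 s t : R := (cos s - cos t) ^+ 2 + (sin s - sin t) ^+ 2.

(** The squared form avoids roots. The chord, unlike |s - t|, is periodic and directly comparable
    with the denominator [qnorm] of the kernels. *)
Definition chord_lipschitz (u : R -> R) :=
  exists2 L, 0 <= L & forall s t, (u s - u t) ^+ 2 <= L * chord2 s t.

Lemma chord2_ge0 s t : 0 <= chord2 s t.
Proof. by rewrite addr_ge0// sqr_ge0. Qed.

Lemma chord_lipschitz_sum n (f : 'I_n -> R -> R) :
  (forall j, chord_lipschitz (f j)) -> chord_lipschitz (fun t => \sum_(j < n) f j t).
Proof.
elim: n f => [|n IH] f fL.
  by exists 0 => // s t; rewrite !big_ord0 subrr expr0n mul0r.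
have [L1 L10 H1] := fL ord0.
have [L2 L20 H2] := IH (fun j => f (lift ord0 j)) (fun j => fL _).
(* From (x + y)^2 <= 2 x^2 + 2 y^2. *)
exists (2 * (L1 + L2)); first by rewrite mulr_ge0// addr_ge0.
move=> s t; rewrite !big_ord_recl; have := H1 s t; have := H2 s t.
set A := f ord0 s; set B := f ord0 t; set D := \sum_(i < n) _; set E := \sum_(i < n) _.
set c := chord2 s t => h2 h1.
have : 0 <= ((A - B) - (D - E)) ^+ 2 by exact: sqr_ge0.
nra.
Qed.

Lemma chord_lipschitz_scale (k : R) (f : R -> R) :
  chord_lipschitz f -> chord_lipschitz (fun t => k * f t).
Proof.
move=> [L L0 H]; exists (k ^+ 2 * L); first by rewrite mulr_ge0// sqr_ge0.
by move=> s t; rewrite -mulrBr exprMn -[leRHS]mulrA ler_wpM2l ?sqr_ge0.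
Qed.

Lemma chord_lipschitz_qnorm a : chord_lipschitz (qnorm a).
Proof.
exists (4 * (Re a ^+ 2 + Im a ^+ 2)); first by rewrite mulr_ge0// addr_ge0// sqr_ge0.
have E s : qnorm a s = 1 - 2 * (Re a * cos s + Im a * sin s) + (Re a ^+ 2 + Im a ^+ 2).
  by rewrite -(q_cauchy a s) /qnorm /qre; ring.
move=> s t; rewrite !E /chord2.
set x := Re a; set y := Im a; set p := cos s - cos t; set q := sin s - sin t.
rewrite (_ : _ - _ = - 2 * (x * p + y * q)); last by rewrite /p /q; ring.
(* By Lagrange's identity this square gives the Cauchy-Schwarz bound (x p + y q)^2 <= (x^2 + y^2)
   (p^2 + q^2). *)
have : 0 <= (x * q - y * p) ^+ 2 by exact: sqr_ge0.
nra.
Qed.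

Lemma chord_lipschitz_comp (g : R -> R) (f : R -> R) (L m : R) :
  chord_lipschitz f -> (forall t, m <= f t) -> 0 <= L ->
  (forall x y, m <= x -> m <= y -> (g x - g y) ^+ 2 <= L * (x - y) ^+ 2) ->
  chord_lipschitz (g \o f).
Proof.
move=> [K K0 H] fm L0 gL; exists (L * K); first by rewrite mulr_ge0.
move=> s t /=; apply: (le_trans (gL _ _ (fm s) (fm t))).
by rewrite -mulrA ler_wpM2l.
Qed.

Lemma chord_lipschitz_inv (f : R -> R) (m : R) : chord_lipschitz f ->
  0 < m -> (forall t, m <= f t) -> chord_lipschitz (fun t => (f t)^-1).
Proof.
(* The square of |1/x - 1/y| <= |x - y| / m^2. *)
move=> fL m0 fm; apply: (chord_lipschitz_comp (L := (m ^+ 4)^-1) fL fm).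
  by rewrite invr_ge0 exprn_ge0// ltW.
move=> x y mx my; have x0 := lt_le_trans m0 mx; have y0 := lt_le_trans m0 my.
have -> : x^-1 - y^-1 = (y - x) / (x * y) by field; rewrite !gt_eqF.
rewrite exprMn mulrC -[(y - x) ^+ 2]sqrrN opprB ler_wpM2r ?sqr_ge0//.
rewrite exprVn lef_pV2 ?posrE ?exprn_gt0 ?mulr_gt0//.
have mxy : m ^+ 2 <= x * y by rewrite expr2 ler_pM// ltW.
have -> : m ^+ 4 = (m ^+ 2) ^+ 2 by rewrite -exprM.
by rewrite lerXn2r ?nnegrE ?sqr_ge0 ?mulr_ge0 ?(ltW x0) ?(ltW y0).
Qed.

Lemma chord_lipschitz_ln (f : R -> R) (m : R) : chord_lipschitz f ->
  0 < m -> (forall t, m <= f t) -> chord_lipschitz (fun t => ln (f t)).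
Proof.
move=> fL m0 fm; apply: (chord_lipschitz_comp (L := (m ^+ 2)^-1) fL fm).
  by rewrite invr_ge0 exprn_ge0// ltW.
(* Write ln x - ln y as ln (1 + (x - y) / y), which is at most (x - y) / y, and use y >= m. *)
have H x y : m <= x -> m <= y -> ln x - ln y <= m^-1 * `|x - y|.
  move=> mx my; have x0 := lt_le_trans m0 mx; have y0 := lt_le_trans m0 my.
  rewrite -ln_div ?posrE//.
  have -> : x / y = 1 + (x - y) / y by rewrite mulrBl divff ?gt_eqF// addrC subrK.
  apply: (le_trans (le_ln1Dx _)).
    by rewrite mulrBl divff ?gt_eqF// ltrBrDl addrN divr_gt0.
  apply: (le_trans (ler_norm _)); rewrite normrM mulrC ler_wpM2r//.
  by rewrite normfV gtr0_norm// lef_pV2 ?posrE.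
move=> x y mx my; rewrite -exprVn -exprMn.
rewrite -[leLHS]real_normK ?num_real// -[leRHS]real_normK ?num_real//.
rewrite lerXn2r ?nnegrE// normrM [X in _ <= X * _]ger0_norm ?invr_ge0 ?(ltW m0)//.
by rewrite ler_norml H// andbT lerNl opprB distrC H.
Qed.

Section kernel_bounds.
Variables (r s t : R).
Hypotheses (r0 : 0 <= r) (r1 : r <= 1).
Let a : C := r%:C%C * eit t.

Let aE : a = (r * cos t +i* (r * sin t))%C.
Proof. by apply: complex_ext; rewrite /a ?Re_mulc ?Im_mulc /= mul0r ?subr0 ?addr0. Qed.

Let c := cos (s - t).

Let c1 : -1 <= c <= 1. Proof. by rewrite cos_geN1 cos_le1. Qed.

Let qreE : qre a s = 1 - r * c.
Proof. by rewrite /qre aE /= /c cosB; ring. Qed.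

Let qimE : qim a s = r * sin (s - t).
Proof. by rewrite /qim aE /= sinB; ring. Qed.

Let qnormE : qnorm a s = 1 - 2 * r * c + r ^+ 2.
Proof.
rewrite /qnorm qreE qimE /c.
transitivity (1 - 2 * r * cos (s - t) +
  r ^+ 2 * (cos (s - t) ^+ 2 + sin (s - t) ^+ 2)); first by ring.
by rewrite cos2Dsin2 mulr1.
Qed.

Let chord2E : chord2 s t = 2 - 2 * c.
Proof.
rewrite /chord2 /c cosB.
transitivity ((cos s ^+ 2 + sin s ^+ 2) + (cos t ^+ 2 + sin t ^+ 2)
  - 2 * (cos s * cos t + sin s * sin t)); first by ring.
by rewrite !cos2Dsin2.
Qed.

(** For z = e^{is} and w = e^{it}: |z - w| <= |z - r w| + (1 - r) <= 2 |z - r w|. *)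
Let chord2_le : chord2 s t <= 4 * qnorm a s.
Proof.
rewrite chord2E qnormE; have /andP[cN cP] := c1.
have h1 : 0 <= (1 + c) * (1 - r) ^+ 2 by rewrite mulr_ge0 ?sqr_ge0//; lra.
have h2 : 0 <= (1 - c) * (r ^+ 2 + 2 * r).
  by rewrite mulr_ge0 ?subr_ge0// addr_ge0 ?sqr_ge0// mulr_ge0.
nra.
Qed.

Let qnorm_le : qnorm a s <= 4 * qre a s.
Proof.
rewrite qreE qnormE; have /andP[cN cP] := c1.
have : r * c <= 1 by rewrite (le_trans (ler_wpM2l r0 cP))// mulr1.
have : r ^+ 2 <= 1 by rewrite exprn_ile1.
lra.
Qed.

Let qnorm_ge0 : 0 <= qnorm a s.
Proof. by rewrite addr_ge0// sqr_ge0. Qed.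

(** With D = [qnorm a s], |k| is at most 2 sqrt D and |w| at most 2 sqrt (L D), so the product is at
    most 4 sqrt L, rounded up to 4 (1 + L). Being uniform in r up to and including r = 1, the bound
    can serve as a dominating constant. For D = 0 the quotient is 0 by convention. *)
Let kernel_mul_bound (k w L : R) : 0 <= L -> w ^+ 2 <= L * chord2 s t ->
  k ^+ 2 <= 4 * qnorm a s -> `|k / qnorm a s * w| <= 4 * (1 + L).
Proof.
move=> L0 wL kD; have [->|D0] := eqVneq (qnorm a s) 0.
  by rewrite invr0 mulr0 mul0r normr0 mulr_ge0// addr_ge0.
have {D0}D0 : 0 < qnorm a s by rewrite lt_neqAle eq_sym D0.
set D := qnorm a s in kD D0 *.
rewrite -(@ler_pXn2r _ 2) ?nnegrE ?mulr_ge0 ?addr_ge0// real_normK ?num_real//.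
rewrite exprMn expr_div_n mulrAC ler_pdivrMr ?exprn_gt0//.
have w4 : w ^+ 2 <= 4 * L * D.
  apply: (le_trans wL); rewrite [4 * L]mulrC -mulrA ler_wpM2l//.
have h : k ^+ 2 * w ^+ 2 <= (4 * D) * (4 * L * D) by rewrite ler_pM ?sqr_ge0.
apply: (le_trans h).
rewrite (_ : 4 * D * (4 * L * D) = 16 * L * D ^+ 2); last by ring.
rewrite ler_wpM2r ?sqr_ge0//.
have := mulr_ge0 L0 L0; nra.
Qed.

Lemma poisson_mul_bound (w L : R) : 0 <= L -> w ^+ 2 <= L * chord2 s t ->
  `|poisson a s * w| <= 4 * (1 + L).
Proof.
move=> L0 wL; apply: kernel_mul_bound => //.
rewrite -(q_cauchy a s).
(* With A = [qre a s] and D = [qnorm a s], the squared numerator is (2 A - D)^2 = 4 A^2 - D (4 A -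
   D), hence at most 4 A^2 <= 4 D. *)
have -> : 1 - ((1 - qre a s) ^+ 2 + qim a s ^+ 2) = 2 * qre a s - qnorm a s.
  by rewrite /qnorm; ring.
have h1 : 0 <= qnorm a s * (4 * qre a s - qnorm a s) by rewrite mulr_ge0// subr_ge0.
have h2 : qre a s ^+ 2 <= qnorm a s by rewrite lerDl sqr_ge0.
nra.
Qed.

Lemma cpoisson_mul_bound (w L : R) : 0 <= L -> w ^+ 2 <= L * chord2 s t ->
  `|cpoisson a s * w| <= 4 * (1 + L).
Proof.
move=> L0 wL; apply: kernel_mul_bound => //.
have h2 : qim a s ^+ 2 <= qnorm a s by rewrite lerDr sqr_ge0.
nra.
Qed.

(** The kernel is singular only where the Lipschitz difference it multiplies vanishes too. *)
Lemma chord2_eq0_qnorm : qnorm a s = 0 -> chord2 s t = 0.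
Proof.
move=> D0; apply/eqP; rewrite eq_le chord2_ge0 andbT.
by have := chord2_le; rewrite D0 mulr0.
Qed.

End kernel_bounds.

Lemma poisson_boundary t s : poisson (eit t) s = 0.
Proof. by rewrite /poisson /= cos2Dsin2 subrr mul0r. Qed.

Lemma normC_scale_eit r t : 0 <= r -> `|r%:C%C * eit t| = r%:C%C :> C.
Proof. by move=> r0; rewrite normrM normr_eit mulr1 ger0_norm// ler0c. Qed.

(** Continuity along a curve x + iy covers both uses: the radius r -> r e^{it} and the circle t -> r
    e^{it}. *)
Lemma continuous_kernel_param (x y : R -> R) s p :
  {for p, continuous x} -> {for p, continuous y} ->
  qnorm (x p +i* y p)%C s != 0 ->
  {for p, continuous (fun p => poisson (x p +i* y p)%C s)} /\
  {for p, continuous (fun p => cpoisson (x p +i* y p)%C s)}.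
Proof.
move=> cx cy D0.
have cre : {for p, continuous (fun p => qre (x p +i* y p)%C s)}.
  rewrite /qre /=; apply: cvgB; [apply: cvgB; first exact: cvg_cst|];
    by apply: cvgM => //; exact: cvg_cst.
have cim : {for p, continuous (fun p => qim (x p +i* y p)%C s)}.
  by rewrite /qim /=; apply: cvgB; apply: cvgM => //; exact: cvg_cst.
have cD : {for p, continuous (fun p => (qnorm (x p +i* y p)%C s)^-1)}.
  by apply: cvgV => //; apply: cvgD; apply: cvgM.
split; apply: cvgM => //; last by apply: cvgM => //; exact: cvg_cst.
by apply: cvgB; [exact: cvg_cst|apply: cvgD; apply: cvgM].
Qed.

End herglotz.

(** * Radial limits of Poisson and conjugate Poisson integrals *)

Section boundary_values.
Context {R : realType}.
Local Notation C := (R[i]).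
Local Notation mu := (@lebesgue_measure R).
Local Notation dom := (@dom R).
Local Notation Re := complex.Re.
Local Notation Im := complex.Im.
Implicit Types (s t r : R) (a z : C).

Lemma scale_eitE r t : r%:C%C * eit t = (r * cos t +i* (r * sin t))%C :> C.
Proof. by apply: complex_ext; rewrite ?Re_mulc ?Im_mulc /= mul0r ?subr0 ?addr0. Qed.

Lemma qnorm_ge0 a s : 0 <= qnorm a s.
Proof. by rewrite addr_ge0// sqr_ge0. Qed.

Lemma measurable_poisson a : measurable_fun setT (poisson a).
Proof.
apply: measurable_funM => //; apply: measurable_invr_ge0; last exact: qnorm_ge0.
by apply: measurable_funD; apply: measurable_funX; apply: continuous_measurable_fun;
  [exact: continuous_qre|exact: continuous_qim].
Qed.

Lemma measurable_cpoisson a : measurable_fun setT (cpoisson a).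
Proof.
apply: measurable_funM; first apply: measurable_funM => //.
  by apply: continuous_measurable_fun; exact: continuous_qim.
apply: measurable_invr_ge0; last exact: qnorm_ge0.
by apply: measurable_funD; apply: measurable_funX; apply: continuous_measurable_fun;
  [exact: continuous_qre|exact: continuous_qim].
Qed.

Lemma lebesgue_dom_lty : (mu dom < +oo)%E.
Proof. by rewrite /Defs.dom lebesgue_measure_itv/= lte_fin; case: ifP => // _; rewrite ltry. Qed.

Lemma bounded_integrable_dom (f : R -> R) (M : R) : measurable_fun dom f ->
  (forall s, dom s -> `|f s| <= M) -> mu.-integrable dom (EFin \o f).
Proof.
move=> mf fM; apply: measurable_bounded_integrable => //.
- exact: measurable_dom.
- exact: lebesgue_dom_lty.
- by exists M; split => [|y My x /fM h] //; [exact: num_real|exact: le_trans h (ltW My)].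
Qed.

Variable u : R -> R.
Hypotheses (cu : continuous u) (uL : chord_lipschitz u).
Hypothesis u2pi : forall t, u (t + pi *+ 2) = u t.

(** The conjugate function of u, up to the factor 1 / (2 pi). The boundary kernel -cot ((s - t) / 2)
    is not integrable; subtracting u t, which costs nothing inside the disc as the kernel has mean
    zero there, makes the integrand bounded and replaces the principal value. *)
Definition conjugate t := integT (fun s => cpoisson (eit t) s * (u s - u t)).

Let measurable_u : measurable_fun setT u. Proof. exact: continuous_measurable_fun. Qed.

Section radial_limit.
Variable K : C -> R -> R.
Hypothesis K_cont : forall (x y : R -> R) s p,
  {for p, continuous x} -> {for p, continuous y} ->
  qnorm (x p +i* y p)%C s != 0 ->
  {for p, continuous (fun p => K (x p +i* y p)%C s)}.
Hypothesis K_bound : forall r s t w L, 0 <= r -> r <= 1 -> 0 <= L ->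
  w ^+ 2 <= L * chord2 s t -> `|K (r%:C%C * eit t) s * w| <= 4 * (1 + L).
Hypothesis mK : forall a, measurable_fun setT (K a).

Lemma radial_limit_difference t :
  integT (fun s => K (r%:C%C * eit t) s * (u s - u t)) @[r --> 1^'-] -->
  integT (fun s => K (eit t) s * (u s - u t)).
Proof.
have [L L0 LH] := uL.
(* Truncating the radius at 1 extends the family to the open interval ]0, 2[, so that 1 is an
   interior point at which continuity under the integral can be used. *)
pose f r s := K ((Num.min r 1)%:C%C * eit t) s * (u s - u t).
have m0 r : 0 < r -> 0 <= Num.min r 1 by move=> r0; rewrite le_min ltW//= ler01.
have m1 r : Num.min r 1 <= 1 by rewrite ge_min lexx orbT.
have fb r s : 0 < r -> `|f r s| <= 4 * (1 + L).
  by move=> r0; exact: K_bound (m0 _ r0) (m1 _) L0 (LH s t).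
have mf r : measurable_fun dom (f r).
  by apply: measurable_funTS; apply: measurable_funM => //; apply: measurable_funB.
have F1 : {for 1, continuous (fun r => \int[mu]_(s in dom) f r s)}.
  apply: (@continuity_under_integral _ _ _ mu f dom measurable_dom 0 2 _ _
    (cst (4 * (1 + L)))).
  - move=> r; rewrite /= in_itv/= => /andP[r0 _].
    by apply: (@bounded_integrable_dom _ (4 * (1 + L))) => // s _; exact: fb.
  - apply: aeW => s _ r; rewrite inE/= in_itv/= => /andP[r0 _].
    have cm : {for r, continuous (fun r : R => Num.min r 1)}.
      by apply: continuous_min => //; exact: cvg_cst.
    (* At a singular point u s = u t, so the integrand is 0 for every radius. *)
    have [D0|D0] := eqVneq (qnorm ((Num.min r 1)%:C%C * eit t) s) 0.
      have us : u s - u t = 0.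
        apply/eqP; rewrite -sqrf_eq0 eq_le sqr_ge0 andbT.
        by have := LH s t; rewrite (chord2_eq0_qnorm (m0 _ r0) D0) mulr0.
      rewrite (_ : f^~ s = cst 0); first exact: cvg_cst.
      by apply/funext => x; rewrite /f us mulr0.
    apply: cvgM; last exact: cvg_cst.
    rewrite (_ : (fun x => _) = (fun r : R =>
      K ((Num.min r 1) * cos t +i* ((Num.min r 1) * sin t))%C s)); last first.
      by apply/funext => x; rewrite scale_eitE.
    rewrite scale_eitE.
    apply: (@K_cont (fun r => Num.min r 1 * cos t) (fun r => Num.min r 1 * sin t)).
    + by apply: cvgM => //; exact: cvg_cst.
    + by apply: cvgM => //; exact: cvg_cst.
    + by rewrite -scale_eitE.
  - by apply: (@bounded_integrable_dom _ (4 * (1 + L))) => // s _ /=; rewrite ger0_norm// mulr_ge0// addr_ge0.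
  - by move=> r; rewrite /= in_itv/= => /andP[r0 _]; apply: aeW => s _; exact: fb.
  - by rewrite inE/= in_itv/= ltr01 ltr1n.
have := cvg_at_left_filter F1.
rewrite {2}/f minxx mul1r => H.
suff : {near 1^'-, (fun r => \int[mu]_(s in dom) f r s) =1
    (fun r => integT (fun s => K (r%:C%C * eit t) s * (u s - u t)))}.
  by move/near_eq_cvg/cvg_trans; apply.
near=> r.
by rewrite /f min_l//; near: r; exact: nbhs_left_le.
Unshelve. all: by end_near. Qed.

(** Inside the disc the kernel has constant mass k, so integrating K u amounts to integrating K (u -
    u t) and adding k u t. *)
Lemma radial_limit t (k : R) :
  (forall r, 0 <= r -> r < 1 -> integT (K (r%:C%C * eit t)) = k) ->
  (forall r, 0 <= r -> r < 1 -> continuous (K (r%:C%C * eit t))) ->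
  integT (fun s => K (r%:C%C * eit t) s * u s) @[r --> 1^'-] -->
  integT (fun s => K (eit t) s * (u s - u t)) + k * u t.
Proof.
move=> Kk cK.
suff : {near 1^'-, (fun r => integT (fun s => K (r%:C%C * eit t) s * (u s - u t)) + k * u t) =1
    (fun r => integT (fun s => K (r%:C%C * eit t) s * u s))}.
  move/near_eq_cvg/cvg_trans; apply; apply: cvgD; last exact: cvg_cst.
  exact: radial_limit_difference.
near=> r.
have r0 : 0 <= r by near: r; exact: nbhs_left_ge.
have r1 : r < 1 by near: r; exact: nbhs_left_lt.
have cKr := cK _ r0 r1.
have cKu : continuous (fun s => K (r%:C%C * eit t) s * (u s - u t)).
  by move=> s; apply: cvgM; [exact: cKr|apply: cvgB; [exact: cu|exact: cvg_cst]].
rewrite -(Kk r)// [_ * u t]mulrC /integT.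
rewrite -RintegralZl//; last exact: continuous_integrable_dom.
rewrite -RintegralD//.
- by apply: eq_Rintegral => s _; ring.
- exact: measurable_dom.
- exact: continuous_integrable_dom.
- by apply: continuous_integrable_dom => s; apply: cvgM; [exact: cvg_cst|exact: cKr].
- exact: measurable_dom.
Unshelve. all: by end_near. Qed.

End radial_limit.

Let eit_scale_lt1 r t : 0 <= r -> r < 1 -> `|r%:C%C * eit t| < 1 :> C.
Proof. by move=> r0 r1; rewrite normC_scale_eit// ltcR. Qed.

Lemma poisson_radial_limit t :
  integT (fun s => poisson (r%:C%C * eit t) s * u s) @[r --> 1^'-] --> (pi *+ 2) * u t.
Proof.
rewrite (_ : pi *+ 2 * u t =
  integT (fun s => poisson (eit t) s * (u s - u t)) + pi *+ 2 * u t); last first.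
  rewrite /integT; under eq_Rintegral do rewrite poisson_boundary mul0r.
  by rewrite Rintegral_cst ?mul0r ?add0r//; exact: measurable_dom.
apply: radial_limit.
- by move=> x y s p cx cy D0; exact: (continuous_kernel_param cx cy D0).1.
- by move=> r s t' w L r0 r1; exact: poisson_mul_bound.
- exact: measurable_poisson.
- by move=> r r0 r1; apply: integT_poisson; exact: eit_scale_lt1.
- by move=> r r0 r1; apply: continuous_poisson; exact: eit_scale_lt1.
Qed.

Lemma cpoisson_radial_limit t :
  integT (fun s => cpoisson (r%:C%C * eit t) s * u s) @[r --> 1^'-] --> conjugate t.
Proof.
rewrite -[conjugate t]addr0 -[X in _ + X](mul0r (u t)).
apply: radial_limit.
- by move=> x y s p cx cy D0; exact: (continuous_kernel_param cx cy D0).2.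
- by move=> r s t' w L r0 r1; exact: cpoisson_mul_bound.
- exact: measurable_cpoisson.
- by move=> r r0 r1; apply: integT_cpoisson; exact: eit_scale_lt1.
- by move=> r r0 r1; apply: continuous_cpoisson; exact: eit_scale_lt1.
Qed.

(** Serves the measurability of [conjugate]. For fixed r < 1 the denominator of the kernel is at
    least (1 - r)^2, so the constant [B] dominates. *)
Lemma continuous_cpoisson_integral r : 0 <= r -> r < 1 ->
  continuous (fun t => integT (fun s => cpoisson (r%:C%C * eit t) s * u s)).
Proof.
move=> r0 r1 t0.
have [M M0 HM] := continuous_periodic_max cu u2pi.
have q1 t s : 1 - r <= qre (r%:C%C * eit t) s.
  rewrite scale_eitE /qre/=.
  have : r * cos (t - s) <= r by rewrite ler_piMr ?cos_le1.
  rewrite cosB; lra.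
have r10 : 0 < 1 - r by rewrite subr_gt0.
have D1 t s : (1 - r) ^+ 2 <= qnorm (r%:C%C * eit t) s.
  apply: (@le_trans _ _ (qre (r%:C%C * eit t) s ^+ 2)); last by rewrite lerDl sqr_ge0.
  by rewrite lerXn2r ?nnegrE ?(ltW r10)//; apply: le_trans (q1 t s); exact: ltW.
have D0 t s : 0 < qnorm (r%:C%C * eit t) s by apply: lt_le_trans (D1 t s); exact: exprn_gt0.
pose B := 2 / (1 - r) ^+ 2 * M.
have fb t s : `|cpoisson (r%:C%C * eit t) s * u s| <= B.
  rewrite normrM ler_pM// /cpoisson normrM normfV ler_pM ?invr_ge0//.
    rewrite normrM normrN normr_nat -[leRHS]mulr1 ler_wpM2l// scale_eitE /qim/=.
    rewrite -mulrA -mulrA -mulrBr -[X in _ * X]opprB mulrN normrN [_ * sin s]mulrC.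
    rewrite [sin s * _]mulrC -sinB normrM ger0_norm// mulr_ile1 ?sin_max//; exact: ltW.
  by rewrite gtr0_norm// lef_pV2 ?posrE// exprn_gt0.
apply: (@continuity_under_integral _ _ _ mu
  (fun t s => cpoisson (r%:C%C * eit t) s * u s) dom measurable_dom (t0 - 1) (t0 + 1) _ _
    (cst B)).
- move=> t _; apply: continuous_integrable_dom => s; apply: cvgM; last exact: cu.
  by apply: continuous_cpoisson; exact: eit_scale_lt1.
- apply: aeW => s _ t _; apply: cvgM; last exact: cvg_cst.
  rewrite (_ : (fun x => _) = (fun t : R =>
      cpoisson (r * cos t +i* (r * sin t))%C s)); last first.
    by apply/funext => x; rewrite scale_eitE.
  have cx : {for t, continuous (fun t => r * cos t)}.
    by apply: cvgM; [exact: cvg_cst|exact: continuous_cos].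
  have cy : {for t, continuous (fun t => r * sin t)}.
    by apply: cvgM; [exact: cvg_cst|exact: continuous_sin].
  have D0' : qnorm (r * cos t +i* (r * sin t))%C s != 0 by rewrite -scale_eitE gt_eqF.
  have [_] := continuous_kernel_param cx cy D0'.
  by rewrite scale_eitE.
- apply: (@bounded_integrable_dom _ B) => // s _ /=.
  by rewrite ger0_norm// mulr_ge0// ?(ltW M0)// divr_ge0// sqr_ge0.
- by move=> t _; apply: aeW => s _; exact: fb.
- by rewrite inE/= in_itv/= ltrDl ltrBlDr ltrDl ltr01.
Qed.

(** A pointwise limit of continuous functions along a sequence of radii tending to 1. *)
Lemma measurable_conjugate : measurable_fun setT conjugate.
Proof.
pose rr (n : nat) : R := 1 - n.+2%:R^-1.
have rr0 n : 0 <= rr n by rewrite subr_ge0 invf_le1 ?ler1n ?ltr0n.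
have rr1 n : rr n < 1 by rewrite ltrBlDr ltrDl invr_gt0 ltr0n.
have rrc : rr n @[n --> \oo] --> (1 : R).
  rewrite -[X in _ --> X]subr0; apply: cvgB; first exact: cvg_cst.
  by have := @cvg_harmonic R; rewrite -cvg_shiftS.
apply: (@measurable_fun_cvg _ _ _ setT
  (fun n t => integT (fun s => cpoisson ((rr n)%:C%C * eit t) s * u s))).
  by move=> n; apply: continuous_measurable_fun; exact: continuous_cpoisson_integral.
move=> t _; have /cvg_at_leftP := cpoisson_radial_limit (t := t).
by apply.
Qed.

End boundary_values.

(** * Boundary values of J^{1/2} *)

Section Jhalf_boundary.
Context {R : realType}.
Local Notation C := (R[i]).
Local Notation mu := (@lebesgue_measure R).
Local Notation dom := (@dom R).
Local Notation Re := complex.Re.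
Local Notation Im := complex.Im.
Variables (N : nat) (alpha : 'I_N -> C).
Hypotheses (N0 : (0 < N)%N) (alpha_lt1 : forall j, `|alpha j| < 1).
Implicit Types (s t r : R) (a z : C).

Definition logJ0 t : R := ln (NJ alpha t / N%:R).

Let NR0 : 0 < N%:R :> R. Proof. by rewrite ltr0n. Qed.

Let J0_gt0 t : 0 < NJ alpha t / N%:R.
Proof. by rewrite divr_gt0// NJ_gt0. Qed.

Let continuous_J0 : continuous (fun t => NJ alpha t / N%:R).
Proof. by move=> t; apply: cvgM; [exact: continuous_NJ|exact: cvg_cst]. Qed.

Let J0_2pi t : NJ alpha (t + pi *+ 2) / N%:R = NJ alpha t / N%:R.
Proof. by rewrite NJ_2pi. Qed.

Lemma continuous_logJ0 : continuous logJ0.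
Proof.
move=> t; apply: (@continuous_comp _ _ _ (fun t => NJ alpha t / N%:R) (@ln R)).
  exact: continuous_J0.
exact: continuous_ln.
Qed.

Lemma logJ0_2pi t : logJ0 (t + pi *+ 2) = logJ0 t.
Proof. by rewrite /logJ0 J0_2pi. Qed.

(** J_0 is a combination of the inverses of [qnorm (alpha j)], each bounded below by compactness,
    and J_0 itself is bounded below; inversion, sums and ln then preserve the chord bound. *)
Lemma chord_lipschitz_logJ0 : chord_lipschitz logJ0.
Proof.
have [m m0 mJ] := continuous_periodic_min continuous_J0 J0_2pi J0_gt0.
apply: chord_lipschitz_ln m0 mJ.
rewrite (_ : (fun t => _) = (fun t => N%:R^-1 * \sum_(j < N)
   (1 - (Re (alpha j) ^+ 2 + Im (alpha j) ^+ 2)) * (qnorm (alpha j) t)^-1)); last first.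
  by apply/funext => t; rewrite mulrC.
apply: chord_lipschitz_scale; apply: chord_lipschitz_sum => j.
apply: chord_lipschitz_scale.
have qp t : qnorm (alpha j) (t + pi *+ 2) = qnorm (alpha j) t.
  by rewrite /qnorm /qre /qim sinD2pi cosD2pi.
have cq : continuous (qnorm (alpha j)).
  by move=> t; apply: cvgD; apply: cvgM; (exact: continuous_qre || exact: continuous_qim).
have [k k0 kq] := continuous_periodic_min cq qp (fun t => qnorm_gt0 t (alpha_lt1 j)).
by apply: (chord_lipschitz_inv _ k0 kq); exact: chord_lipschitz_qnorm.
Qed.

Lemma herglotzJE z : `|z| < 1 -> herglotzJ alpha z =
  ((pi *+ 2)^-1 * integT (fun s => poisson z s * logJ0 s) +i*
   ((pi *+ 2)^-1 * integT (fun s => cpoisson z s * logJ0 s)))%C.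
Proof.
move=> z1; rewrite /herglotzJ /cintT.
have E s : (eit s + z) / (eit s - z) * (ln (Re (J0 alpha (eit s))))%:C%C =
   (poisson z s * logJ0 s +i* (cpoisson z s * logJ0 s))%C.
  rewrite herglotz_kernelE// J0_eit// -/(logJ0 s).
  by apply: complex_ext; rewrite ?Re_mulc ?Im_mulc /= mulr0 ?subr0 ?add0r.
under [in X in (X +i* _)%C]eq_fun do rewrite E /=.
under [in X in (_ +i* X)%C]eq_fun do rewrite E /=.
have p0 : pi *+ 2 != 0 :> R by rewrite gt_eqF// tpi_gt0.
rewrite -fmorphV; apply: complex_ext; rewrite ?Re_mulc ?Im_mulc /= mulr0 ?subr0 ?add0r 1?mulrC//.
Qed.

Definition Jarg t : R := (pi *+ 2)^-1 * conjugate logJ0 t.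

(** The real and imaginary parts of the Herglotz integral converge separately and exp is continuous.
    The phase [Jarg t / 2] drops out of |J^{1/2}|^2; what remains to be known about it is
    measurability. *)
Lemma JhalfE t : Jhalf alpha (eit t) =
  (expR (logJ0 t / 2) * cos (Jarg t / 2) +i* (expR (logJ0 t / 2) * sin (Jarg t / 2)))%C.
Proof.
have p0 : pi *+ 2 != 0 :> R by rewrite gt_eqF// tpi_gt0.
pose A r := (pi *+ 2)^-1 * integT (fun s => poisson (r%:C%C * eit t) s * logJ0 s).
pose B r := (pi *+ 2)^-1 * integT (fun s => cpoisson (r%:C%C * eit t) s * logJ0 s).
have cA : A r / 2 @[r --> 1^'-] --> logJ0 t / 2.
  apply: cvgM; last exact: cvg_cst.
  rewrite -[logJ0 t](mulKf p0); apply: cvgM; first exact: cvg_cst.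
  apply: poisson_radial_limit; first exact: continuous_logJ0.
  exact: chord_lipschitz_logJ0.
have cB : B r / 2 @[r --> 1^'-] --> Jarg t / 2.
  apply: cvgM; last exact: cvg_cst.
  apply: cvgM; first exact: cvg_cst.
  apply: cpoisson_radial_limit; first exact: continuous_logJ0.
  exact: chord_lipschitz_logJ0.
have JE r : 0 <= r -> r < 1 -> Jhalf_in alpha (r%:C%C * eit t) =
    (expR (A r / 2) * cos (B r / 2) +i* (expR (A r / 2) * sin (B r / 2)))%C.
  move=> r0 r1; rewrite /Jhalf_in herglotzJE ?normC_scale_eit ?ltcR//.
  have -> : (A r +i* B r)%C / 2 = (A r / 2 +i* (B r / 2))%C :> C.
    have -> : 2^-1 = (2^-1)%:C%C :> C by rewrite fmorphV rmorph_nat.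
    by apply: complex_ext; rewrite ?Re_mulc ?Im_mulc /= mulr0 ?subr0 ?add0r // mulrC.
  by [].
have cE : expR (A r / 2) @[r --> 1^'-] --> expR (logJ0 t / 2).
  by apply: continuous_cvg cA; exact: continuous_expR.
rewrite /Jhalf; apply: complex_ext => /=.
- apply/cvg_lim => //.
  suff : {near 1^'-, (fun r : R => expR (A r / 2) * cos (B r / 2)) =1
      (fun r => Re (Jhalf_in alpha (r%:C%C * eit t)))}.
    move/near_eq_cvg/cvg_trans; apply; apply: cvgM => //.
    by apply: continuous_cvg cB; exact: continuous_cos.
  near=> r.
  have r0 : 0 <= r by near: r; exact: nbhs_left_ge.
  have r1 : r < 1 by near: r; exact: nbhs_left_lt.
  by rewrite JE.
- apply/cvg_lim => //.
  suff : {near 1^'-, (fun r : R => expR (A r / 2) * sin (B r / 2)) =1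
      (fun r => Im (Jhalf_in alpha (r%:C%C * eit t)))}.
    move/near_eq_cvg/cvg_trans; apply; apply: cvgM => //.
    by apply: continuous_cvg cB; exact: continuous_sin.
  near=> r.
  have r0 : 0 <= r by near: r; exact: nbhs_left_ge.
  have r1 : r < 1 by near: r; exact: nbhs_left_lt.
  by rewrite JE.
Unshelve. all: by end_near. Qed.

Lemma abs2_Jhalf t : abs2T (Jhalf alpha) t = NJ alpha t / N%:R.
Proof.
rewrite /abs2T /reT /imT JhalfE /= !exprMn -mulrDr cos2Dsin2 mulr1.
by rewrite expr2 -expRD -splitr lnK// posrE.
Qed.

Lemma measT_Jhalf : measT (Jhalf alpha).
Proof.
have mA : measurable_fun setT Jarg.
  apply: measurable_funM => //; apply: measurable_conjugate.
  - exact: continuous_logJ0.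
  - exact: chord_lipschitz_logJ0.
  - exact: logJ0_2pi.
have mE : measurable_fun setT (fun t => expR (logJ0 t / 2)).
  apply: measurableT_comp => //; apply: measurable_funM => //.
  by apply: continuous_measurable_fun; exact: continuous_logJ0.
have mA2 : measurable_fun setT (fun t => Jarg t / 2) by exact: measurable_funM.
split; apply: measurable_funTS.
- rewrite (_ : reT _ = (fun t => expR (logJ0 t / 2) * cos (Jarg t / 2))); last first.
    by apply/funext => t; rewrite /reT JhalfE.
  apply: measurable_funM => //; apply: measurableT_comp mA2.
  by apply: continuous_measurable_fun; exact: continuous_cos.
- rewrite (_ : imT _ = (fun t => expR (logJ0 t / 2) * sin (Jarg t / 2))); last first.
    by apply/funext => t; rewrite /imT JhalfE.
  apply: measurable_funM => //; apply: measurableT_comp mA2.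
  by apply: continuous_measurable_fun; exact: continuous_sin.
Qed.

End Jhalf_boundary.

(** * Function spaces and almost-everywhere statements on the circle *)

Section function_spaces.
Context {R : realType}.
Local Notation C := (R[i]).
Local Notation mu := (@lebesgue_measure R).
Local Notation dom := (@dom R).
Local Notation Re := complex.Re.
Local Notation Im := complex.Im.
Implicit Types (f g h : C -> C) (P Q : R -> Prop) (x y z : C) (t : R).

(** |z|^2 as an element of R, whereas the norm of R[i] takes its values in R[i]. *)
Definition nsq z : R := Re z ^+ 2 + Im z ^+ 2.

Lemma nsq_ge0 z : 0 <= nsq z. Proof. by rewrite addr_ge0// sqr_ge0. Qed.

Lemma nsqM x y : nsq (x * y) = nsq x * nsq y.
Proof. by rewrite /nsq Re_mulc Im_mulc; ring. Qed.

Lemma nsq_conj z : nsq z^* = nsq z.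
Proof. by case: z => a b; rewrite /nsq /= sqrrN. Qed.

Lemma nsq0 : nsq 0 = 0. Proof. by rewrite /nsq /= expr0n addr0. Qed.

Lemma nsq1 : nsq 1 = 1. Proof. by rewrite /nsq /= expr1n expr0n addr0. Qed.

Lemma nsq_eq0 z : (nsq z == 0) = (z == 0).
Proof. by rewrite paddr_eq0 ?sqr_ge0// !sqrf_eq0 eq_complex. Qed.

Lemma nsqV z : nsq z^-1 = (nsq z)^-1.
Proof.
have [->|z0] := eqVneq z 0; first by rewrite invr0 nsq0 invr0.
have nz0 : nsq z != 0 by rewrite nsq_eq0.
by apply: (mulIf nz0); rewrite -nsqM !mulVf// nsq1.
Qed.

Lemma nsqD x y : nsq (x + y) <= 2 * nsq x + 2 * nsq y.
Proof.
case: x y => [a b] [c d]; rewrite /nsq /=.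
have := sqr_ge0 (a - c); have := sqr_ge0 (b - d); nra.
Qed.

Lemma nsq_real (r : R) : nsq r%:C%C = r ^+ 2.
Proof. by rewrite /nsq /= expr0n addr0. Qed.

Lemma conj_mul_nsq z : z^* * z = (nsq z)%:C%C.
Proof. by case: z => a b; apply: complex_ext; rewrite /nsq /=; ring. Qed.

(** Iterating |x + y|^2 <= 2 |x|^2 + 2 |y|^2 gives the crude constant 2^n, which suffices for
    boundedness as n = N is fixed. *)
Lemma nsq_sum n (F : 'I_n -> C) :
  nsq (\sum_(k < n) F k) <= 2 ^+ n * \sum_(k < n) nsq (F k).
Proof.
elim: n F => [|n IH] F; first by rewrite !big_ord0 nsq0 mulr0.
rewrite !big_ord_recl; apply: (le_trans (nsqD _ _)); rewrite [leRHS]mulrDr; apply: lerD.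
  by rewrite ler_wpM2r ?nsq_ge0// exprS ler_peMr// exprn_ege1// ler1n.
by rewrite exprS -mulrA ler_wpM2l.
Qed.

Lemma ReIm_conjM_le x y : `|Re (x^* * y)| <= nsq x + nsq y /\
  `|Im (x^* * y)| <= nsq x + nsq y.
Proof.
case: x y => [a b] [c d]; rewrite /nsq /= !ler_norml.
have h1 := sqr_ge0 (a - c); have h2 := sqr_ge0 (b - d).
have h3 := sqr_ge0 (a + c); have h4 := sqr_ge0 (b + d).
have h5 := sqr_ge0 (a - d); have h6 := sqr_ge0 (b - c).
have h7 := sqr_ge0 (a + d); have h8 := sqr_ge0 (b + c).
by split; apply/andP; split; nra.
Qed.

Lemma aeTP P : aeT P <-> {ae mu, forall t, dom t -> P t}.
Proof.
split=> [[Nn [nN H]]|H].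
  apply: negligibleS nN => t /=; apply: contra_notP => nt dt; exact: H.
exists (~` [set t | dom t -> P t]); split => // t dt /contrapT; exact.
Qed.

Lemma aeT_all P : (forall t, P t) -> aeT P.
Proof. by move=> H; apply/aeTP; apply: aeW => t _. Qed.

Lemma aeT_sub P Q : (forall t, dom t -> P t -> Q t) -> aeT P -> aeT Q.
Proof.
by move=> PQ [M [M0 H]]; exists M; split => // t dt Mt; apply: PQ => //; exact: H.
Qed.

Lemma aeT_and P Q : aeT P -> aeT Q -> aeT (fun t => P t /\ Q t).
Proof.
move=> [M [M0 H]] [M' [M'0 K]]; exists (M `|` M'); split; first exact: negligibleU.
by move=> t dt /not_orP[nM nM']; split; [exact: H|exact: K].
Qed.

Lemma aeT_sub2 P Q (U : R -> Prop) : (forall t, dom t -> P t -> Q t -> U t) ->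
  aeT P -> aeT Q -> aeT U.
Proof.
move=> PQ H K; apply: aeT_sub (aeT_and H K) => t dt []; exact: PQ.
Qed.

Lemma aeT_ord n (P : 'I_n -> R -> Prop) :
  (forall i, aeT (P i)) -> aeT (fun t => forall i, P i t).
Proof.
elim: n P => [|n IH] P H; first by apply: aeT_all => t [].
apply: aeT_sub2 (H ord0) (IH (fun i => P (lift ord0 i)) (fun i => H _)) => t _ h0 hS i.
by case: (unliftP ord0 i) => [j ->|->].
Qed.

Lemma aeq_refl f : aeq f f. Proof. exact: aeT_all. Qed.

Lemma aeq_sym f g : aeq f g -> aeq g f.
Proof. by apply: aeT_sub => t _ ->. Qed.

Lemma aeq_trans g f h : aeq f g -> aeq g h -> aeq f h.
Proof. by apply: aeT_sub2 => t _ -> ->. Qed.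

Lemma aeq_pointwise f g : (forall t, f (eit t) = g (eit t)) -> aeq f g.
Proof. exact: aeT_all. Qed.

Lemma reT_2pi f t : reT f (t + pi *+ 2) = reT f t.
Proof. by rewrite /reT eit_2pi. Qed.

Lemma imT_2pi f t : imT f (t + pi *+ 2) = imT f t.
Proof. by rewrite /imT eit_2pi. Qed.

(** Measurability is given on [dom] only, but composing with phi and its inverse leaves [dom];
    precomposition with [modT] extends it to the line. *)
Lemma measurable_periodic (k : R -> R) : (forall t, k (t + pi *+ 2) = k t) ->
  measurable_fun dom k -> measurable_fun setT k.
Proof.
move=> pk mk; rewrite (_ : k = k \o modT (pi *+ 2)); last first.
  by apply/funext => t /=; rewrite periodic_modT.
apply: (measurable_comp measurable_dom) mk (measurable_modT (@tpi_gt0 R)).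
by move=> _ [t _ <-]; exact: dom_modT.
Qed.

Lemma measTP f : measT f <->
  measurable_fun setT (reT f) /\ measurable_fun setT (imT f).
Proof.
split=> [[mr mi]|[mr mi]]; last by split; exact: measurable_funTS.
by split; apply: measurable_periodic => // t; rewrite ?reT_2pi ?imT_2pi.
Qed.

Lemma measT_cst z : measT (cst z).
Proof. by split; exact: measurable_cst. Qed.

Lemma measT_add f g : measT f -> measT g -> measT (fun z => f z + g z).
Proof.
move=> [fr fi] [gr gi]; split.
  rewrite (_ : reT _ = reT f \+ reT g); first exact: measurable_funD.
  by apply/funext => t; rewrite /reT /=; case: (f _) (g _) => ? ? [].
rewrite (_ : imT _ = imT f \+ imT g); first exact: measurable_funD.
by apply/funext => t; rewrite /imT /=; case: (f _) (g _) => ? ? [].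
Qed.

Lemma measT_mul f g : measT f -> measT g -> measT (fun z => f z * g z).
Proof.
move=> [fr fi] [gr gi]; split.
  rewrite (_ : reT _ = (reT f \* reT g) \- (imT f \* imT g)).
    by apply: measurable_funB; apply: measurable_funM.
  by apply/funext => t; rewrite /reT Re_mulc.
rewrite (_ : imT _ = (reT f \* imT g) \+ (imT f \* reT g)).
  by apply: measurable_funD; apply: measurable_funM.
by apply/funext => t; rewrite /imT Im_mulc.
Qed.

Lemma measT_conj f : measT f -> measT (fun z => (f z)^*).
Proof.
move=> [fr fi]; split.
  by rewrite (_ : reT _ = reT f)//; apply/funext => t; rewrite /reT; case: (f _).
rewrite (_ : imT _ = \- (imT f)); first exact: measurable_funN.
by apply/funext => t; rewrite /imT /=; case: (f _).
Qed.

Lemma measurable_abs2T f : measT f -> measurable_fun dom (abs2T f).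
Proof. by move=> [fr fi]; apply: measurable_funD; apply: measurable_funX. Qed.

Lemma measT_inv f : measT f -> measT (fun z => (f z)^-1).
Proof.
move=> mf; have [fr fi] := mf.
have mV : measurable_fun dom (fun t => (abs2T f t)^-1).
  by apply: measurable_invr_ge0; [exact: measurable_abs2T|move=> t; exact: nsq_ge0].
split.
  rewrite (_ : reT _ = (fun t => reT f t * (abs2T f t)^-1)); first exact: measurable_funM.
  by apply/funext => t; rewrite /abs2T /reT /imT; case: (f _).
rewrite (_ : imT _ = (fun t => - imT f t * (abs2T f t)^-1)).
  by apply: measurable_funM => //; exact: measurable_funN.
by apply/funext => t; rewrite /abs2T /reT /imT mulNr; case: (f _).
Qed.

Lemma measT_nsq f : measT f -> measT (fun z => (nsq (f z))%:C%C).
Proof.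
move=> mf; rewrite (_ : (fun z => _) = (fun z => (f z)^* * f z)).
  by apply: measT_mul => //; exact: measT_conj.
by apply/funext => z; rewrite conj_mul_nsq.
Qed.

Lemma abs2TE f t : abs2T f t = nsq (f (eit t)). Proof. by []. Qed.

Lemma abs2T_ge0 f t : 0 <= abs2T f t. Proof. exact: nsq_ge0. Qed.

(** Valued in the extended reals, so that estimates can precede, and then prove, square
    integrability. *)
Definition int_abs2 f : \bar R := (\int[mu]_(t in dom) (abs2T f t)%:E)%E.

Lemma int_abs2_ge0 f : (0 <= int_abs2 f)%E.
Proof. by apply: integral_ge0 => t _; rewrite lee_fin abs2T_ge0. Qed.

Lemma L2P f : L2 f <-> measT f /\ (int_abs2 f < +oo)%E.
Proof.
have E : int_abs2 f = (\int[mu]_(t in dom) `|(abs2T f t)%:E|)%E.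
  by apply: eq_integral => t _; rewrite gee0_abs// lee_fin abs2T_ge0.
split=> [[mf /integrableP[_ If]]|[mf If]]; first by rewrite E.
split => //; apply/integrableP; split; first by apply/measurable_EFinP; exact: measurable_abs2T.
by rewrite -E.
Qed.

Lemma int_abs2_le f g (c : R) : 0 <= c -> measT f -> measT g ->
  aeT (fun t => abs2T f t <= c * abs2T g t) ->
  (int_abs2 f <= c%:E * int_abs2 g)%E.
Proof.
move=> c0 mf mg /aeTP fg; rewrite /int_abs2 -ge0_integralZl//; last first.
- by move=> t _; rewrite lee_fin abs2T_ge0.
- by apply/measurable_EFinP; exact: measurable_abs2T.
- exact: measurable_dom.
apply: ae_ge0_le_integral => //.
- exact: measurable_dom.
- by move=> t _; rewrite lee_fin abs2T_ge0.
- by apply/measurable_EFinP; exact: measurable_abs2T.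
- by move=> t _; rewrite -EFinM lee_fin mulr_ge0// abs2T_ge0.
- by apply/measurable_EFinP; apply: measurable_funM => //; exact: measurable_abs2T.
Qed.

Lemma L2_le f g (c : R) : 0 <= c -> measT f -> L2 g ->
  aeT (fun t => abs2T f t <= c * abs2T g t) -> L2 f.
Proof.
move=> c0 mf /L2P[mg Ig] fg; apply/L2P; split => //.
apply: (le_lt_trans (int_abs2_le c0 mf mg fg)).
rewrite lte_mul_pinfty// ge0_fin_numE// int_abs2_ge0.
Qed.

Lemma norm2_le f g (c : R) : 0 <= c -> L2 g ->
  (int_abs2 f <= c%:E * int_abs2 g)%E -> norm2 f <= Num.sqrt c * norm2 g.
Proof.
move=> c0 /L2P[_ Ig] fg; rewrite /norm2 -sqrtrM// ler_wsqrtr// mulrA.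
rewrite ler_pM2r ?invr_gt0 ?tpi_gt0// /integT /Rintegral -!/(int_abs2 _).
have gf : int_abs2 g \is a fin_num by rewrite ge0_fin_numE// int_abs2_ge0.
rewrite -[leLHS]/(fine _) (_ : c * _ = fine (c%:E * int_abs2 g)%E); last by rewrite fineM.
rewrite fine_le// ?fin_numM// ge0_fin_numE ?int_abs2_ge0//.
by apply: (le_lt_trans fg); rewrite ltey_eq fin_numM.
Qed.

Lemma Linf_bounded f (M : R) : measT f -> (forall t, abs2T f t <= M) -> Linf f.
Proof. by move=> mf fM; split => //; exists M; exact: aeT_all. Qed.

Lemma Linf_mul_L2 f g : Linf f -> L2 g -> L2 (fun z => f z * g z).
Proof.
move=> [mf [M fM]] Lg; have [mg _] := Lg.
apply: (L2_le (c := `|M|)) Lg _ => //; first exact: measT_mul.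
apply: aeT_sub fM => t _ fM; rewrite !abs2TE nsqM.
by rewrite ler_wpM2r ?nsq_ge0// (le_trans fM)// ler_norm.
Qed.

Lemma L2_cst z : L2 (cst z).
Proof.
apply/L2P; split; first exact: measT_cst.
rewrite /int_abs2 (_ : (fun t => _) = cst (nsq z)%:E)//.
by rewrite integral_cst ?lte_mul_pinfty ?lee_fin ?nsq_ge0 ?lebesgue_dom_lty//;
  exact: measurable_dom.
Qed.

Lemma Linf_L2 f : Linf f -> L2 f.
Proof.
move=> Lf; rewrite (_ : f = (fun z => f z * cst 1 z)).
  by apply: Linf_mul_L2 => //; exact: L2_cst.
by apply/funext => z; rewrite mulr1.
Qed.

Lemma L2_conjM_integrable f g : L2 f -> L2 g ->
  mu.-integrable dom (EFin \o (fun t => Re ((f (eit t))^* * g (eit t)))) /\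
  mu.-integrable dom (EFin \o (fun t => Im ((f (eit t))^* * g (eit t)))).
Proof.
move=> [mf If] [mg Ig].
have [mr mi] := measT_mul (measT_conj mf) mg.
have Ifg : mu.-integrable dom (fun t => (abs2T f t)%:E + (abs2T g t)%:E)%E.
  by apply: integrableD => //; exact: measurable_dom.
split; apply: le_integrable Ifg; try exact: measurable_dom.
- exact/measurable_EFinP.
- move=> t _; rewrite /= lee_fin; apply: (le_trans (ReIm_conjM_le _ _).1).
  by rewrite ler_norm.
- exact/measurable_EFinP.
- move=> t _; rewrite /= lee_fin; apply: (le_trans (ReIm_conjM_le _ _).2).
  by rewrite ler_norm.
Qed.

Lemma integT_aeq (k l : R -> R) : measurable_fun dom k -> measurable_fun dom l ->
  aeT (fun t => k t = l t) -> integT k = integT l.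
Proof.
move=> mk ml /aeTP kl; rewrite /integT /Rintegral; congr fine.
apply: ae_eq_integral => //; first exact: measurable_dom.
- exact/measurable_EFinP.
- exact/measurable_EFinP.
- by apply: negligibleS kl; apply: subsetC => t kl dt; rewrite kl.
Qed.

Lemma aeT_eq0_integral (k : R -> R) : measurable_fun dom k -> (forall t, 0 <= k t) ->
  (\int[mu]_(t in dom) (k t)%:E = 0)%E -> aeT (fun t => k t = 0).
Proof.
move=> mk k0 I0; apply/aeTP.
have mkE : measurable_fun dom (EFin \o k) by exact/measurable_EFinP.
have /(ae_eq_integral_abs mu measurable_dom mkE) : (\int[mu]_(t in dom) `|(k t)%:E| = 0)%E.
  by rewrite -[RHS]I0; apply: eq_integral => t _; rewrite gee0_abs// lee_fin.
by apply: negligibleS; apply: subsetC => t H dt; case: (H dt).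
Qed.

End function_spaces.

(** * Transport of integrals and null sets along the fibres of b *)

Section fiber_transport.
Context {R : realType}.
Local Notation C := (R[i]).
Local Notation mu := (@lebesgue_measure R).
Local Notation dom := (@dom R).
Local Notation T := (pi *+ 2 : R).
Local Notation Re := complex.Re.
Local Notation Im := complex.Im.
Variables (N : nat) (alpha : 'I_N -> C).
Hypotheses (N0 : (0 < N)%N) (alpha_lt1 : forall j, `|alpha j| < 1).
Variables (phi psi : R -> R).
Hypothesis bE : forall t, blaschke alpha (eit t) = eit (phi t).
Hypothesis dphi : forall t : R, is_derive t (1 : R) phi (NJ alpha t).
Hypotheses (phiK : cancel phi psi) (psiK : cancel psi phi).
Hypothesis phi_mono : {mono phi : x y / x <= y}.
Hypothesis phiT : forall t, phi (t + T) = phi t + T *+ N.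
Implicit Types (f g m xi : C -> C) (t s : R) (h : R -> R).
Local Notation b := (blaschke alpha).
Local Notation L := (transfer alpha).
Local Notation J := (Jhalf alpha).

Let NR0 : 0 < N%:R :> R. Proof. by rewrite ltr0n. Qed.

Definition fiber (k : nat) t := psi (t + T *+ k).
Arguments fiber : simpl never.

Lemma blaschke_fiber k t : b (eit (fiber k t)) = eit t.
Proof. by rewrite bE psiK (periodic_natmul (f := eit))//; exact: eit_2pi. Qed.

Lemma fiber0_phi t : fiber 0 (phi t) = t.
Proof. by rewrite /fiber mulr0n addr0 phiK. Qed.

Lemma transferE xi t : L xi (eit t) = N%:R^-1 * \sum_(k < N) xi (eit (fiber k t)).
Proof. exact: transfer_eit bE phiK psiK phiT. Qed.

Lemma measurable_phi : measurable_fun setT phi.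
Proof. by apply: nondecreasing_measurable => // x y; rewrite phi_mono. Qed.

Lemma measurable_fiber k : measurable_fun setT (fiber k).
Proof.
apply: measurableT_comp; last exact: measurable_funD.
by apply: nondecreasing_measurable => // x y xy; rewrite -phi_mono !psiK.
Qed.

Lemma measurable_NJ : measurable_fun setT (NJ alpha).
Proof. by apply: continuous_measurable_fun; exact: continuous_NJ. Qed.

Let NJ0 t : 0 < NJ alpha t. Proof. exact: NJ_gt0. Qed.

Lemma ge0_integral_fiber h : measurable_fun setT h -> (forall t, 0 <= h t) ->
  (forall t, h (t + T) = h t) ->
  (\int[mu]_(t in dom) (\sum_(k < N) h (fiber k t))%:E =
   \int[mu]_(t in dom) (h t * NJ alpha t)%:E)%E.
Proof.
move=> mh h0 hT.
have mS : measurable_fun setT (fun t => \sum_(k < N) h (fiber k t)).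
  by apply: measurable_sum => k; apply: measurableT_comp => //; exact: measurable_fiber.
rewrite /Defs.dom -!integral_itv_bndo_bndc; last 2 first.
- apply: measurable_funTS; apply/measurable_EFinP; apply: measurable_funM => //.
  exact: measurable_NJ.
- by apply: measurable_funTS; exact/measurable_EFinP.
under eq_integral do rewrite -sumEFin.
under [RHS]eq_integral do rewrite EFinM.
apply: (ge0_integral_fiber_sum (phi := phi) (psi := psi) (g := EFin \o h)) => //.
- exact: tpi_gt0.
- exact: continuous_NJ.
- by move=> x; exact: ltW.
- exact: NJ_2pi.
- exact/measurable_EFinP.
- by move=> t /=; rewrite hT.
Qed.

Lemma modT_id t : 0 <= t -> t < T -> modT T t = t.
Proof.
move=> t0 tT; rewrite /modT (_ : Num.floor (t / T) = 0) ?mulr0z ?subr0//.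
apply/eqP; rewrite floor_eq; rewrite ?divr_ge0 ?(ltW (tpi_gt0 _))//=.
by rewrite ltr_pdivrMr ?mul1r// tpi_gt0.
exact/ltW/tpi_gt0.
Qed.

(** Replaces the exceptional set, known only inside [dom], by a measurable set read modulo the
    period; its indicator is then a periodic function to which the fibre formula applies. *)
Lemma aeT_modT (P : R -> Prop) : aeT P -> exists A : set R,
  [/\ measurable A, aeT (fun t => ~ A (modT T t)) &
      forall t, ~ A (modT T t) -> P (modT T t)].
Proof.
move=> [M [[A [mA A0 MA]] H]]; exists A; split => //.
  (* Reduction sends the endpoint T to 0, so T joins the exceptional set. *)
  exists (A `|` [set T]); split.
    exists (A `|` [set T]); split => //; first exact: measurableU.
    by rewrite measureU0//; exact: lebesgue_measure_set1.
  move=> t; rewrite /Defs.dom /= in_itv/= => /andP[t0 tT] /not_orP[nA nT].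
  rewrite modT_id// lt_neqAle tT andbT; exact/eqP.
by move=> t nA; apply: H; [exact: dom_modT|move=> /MA].
Qed.

Definition indic_modT (A : set R) t : R := \1_A (modT T t).

Lemma measurable_indic_modT (A : set R) : measurable A ->
  measurable_fun setT (indic_modT A).
Proof.
move=> mA; apply: (measurableT_comp (f := (\1_A : R -> R))).
  exact: measurable_indic.
by apply: measurable_modT; exact: tpi_gt0.
Qed.

Lemma indic_modT_ge0 (A : set R) t : 0 <= indic_modT A t.
Proof. by rewrite /indic_modT indicE; case: (_ \in _). Qed.

Lemma indic_modT_2pi (A : set R) t : indic_modT A (t + T) = indic_modT A t.
Proof.
rewrite /indic_modT; congr (\1_A _).
rewrite /modT mulrDl divff ?gt_eqF ?tpi_gt0// floorDrz// floor1 mulrzDr mulr1z; ring.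
Qed.

Section null_sets.
Variable Q : C -> Prop.
Hypothesis aeQ : aeT (fun t => Q (eit t)).

Let Q_modT t : Q (eit (modT T t)) -> Q (eit t).
Proof. by rewrite (periodic_modT (f := eit)) //; exact: eit_2pi. Qed.

(** Images of null sets: the fibre sum of the indicator h of the bad set has the same integral as h
    NJ, which is 0, so almost every fibre avoids the bad set. *)
Lemma aeT_fiber : aeT (fun t => forall k : 'I_N, Q (eit (fiber k t))).
Proof.
have [A [mA nA AQ]] := aeT_modT aeQ.
pose h := indic_modT A; have mh := measurable_indic_modT mA.
have h0 := indic_modT_ge0 A; have hT := indic_modT_2pi A.
have I0 : (\int[mu]_(t in dom) (\sum_(k < N) h (fiber k t))%:E = 0)%E.
  rewrite ge0_integral_fiber//.
  transitivity (\int[mu]_(t in dom) (0 : \bar R))%E; last exact: integral0.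
  apply: ae_eq_integral => //; first exact: measurable_dom.
  - apply/measurable_EFinP; apply: measurable_funTS; apply: measurable_funM => //.
    exact: measurable_NJ.
  - have /aeTP : aeT (fun t => h t * NJ alpha t = 0).
      apply: aeT_sub nA => t _ nA; rewrite /h /indic_modT indicE memNset//.
      by rewrite mul0r.
    by apply: negligibleS; apply: subsetC => t /= H dt; rewrite H.
have : aeT (fun t => \sum_(k < N) h (fiber k t) = 0).
  apply: aeT_eq0_integral I0; last by move=> t; rewrite sumr_ge0.
  apply: measurable_funTS; apply: measurable_sum => k.
  by apply: measurableT_comp => //; exact: measurable_fiber.
apply: aeT_sub => t _ S0 k; apply: Q_modT; apply: AQ => Ak.
have : 0 < \sum_(k < N) h (fiber k t); last by rewrite S0 ltxx.
rewrite (bigD1 k)//= ltr_pwDl ?sumr_ge0// /h /indic_modT indicE mem_set//.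
Qed.

(** Preimages of null sets: h o phi is constant on a fibre, so its fibre sum vanishes almost
    everywhere and (h o phi) NJ has integral 0. Positivity of NJ then removes the weight. *)
Lemma aeT_blaschke : aeT (fun t => Q (b (eit t))).
Proof.
have [A [mA nA AQ]] := aeT_modT aeQ.
pose h := indic_modT A; have mh := measurable_indic_modT mA.
have h0 := indic_modT_ge0 A; have hT := indic_modT_2pi A.
have mhp : measurable_fun setT (h \o phi) by apply: measurableT_comp => //; exact: measurable_phi.
have I0 : (\int[mu]_(t in dom) (h (phi t) * NJ alpha t)%:E = 0)%E.
  rewrite -(@ge0_integral_fiber (h \o phi))//; last first.
    by move=> t /=; rewrite phiT (periodic_natmul (f := h)).
  transitivity (\int[mu]_(t in dom) (0 : \bar R))%E; last exact: integral0.
  apply: ae_eq_integral => //; first exact: measurable_dom.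
  - apply/measurable_EFinP; apply: measurable_funTS; apply: measurable_sum => k.
    by apply: measurableT_comp => //; exact: measurable_fiber.
  - have /aeTP : aeT (fun t => \sum_(k < N) (h \o phi) (fiber k t) = 0).
      apply: aeT_sub nA => t _ nA; rewrite big1// => k _ /=.
      by rewrite psiK (periodic_natmul (f := h))// /h /indic_modT indicE memNset.
    by apply: negligibleS; apply: subsetC => t /= H dt; rewrite H.
have : aeT (fun t => h (phi t) * NJ alpha t = 0).
  apply: aeT_eq0_integral I0; last by move=> t; rewrite mulr_ge0// ltW.
  by apply: measurable_funTS; apply: measurable_funM => //; exact: measurable_NJ.
apply: aeT_sub => t _ /eqP; rewrite mulf_eq0 (gt_eqF (NJ0 t)) orbF => /eqP h1.
rewrite bE; apply: Q_modT; apply: AQ => Ak.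
by move: h1; rewrite /h /indic_modT indicE mem_set// => /eqP; rewrite oner_eq0.
Qed.

End null_sets.

(** Positive and negative parts are treated separately; their fibre sums must be shown integrable
    before they are subtracted. *)
Lemma integT_fiber h : measurable_fun setT h -> (forall t, h (t + T) = h t) ->
  mu.-integrable dom (EFin \o (fun t => h t * NJ alpha t)) ->
  integT (fun t => \sum_(k < N) h (fiber k t)) = integT (fun t => h t * NJ alpha t).
Proof.
move=> mh hT ih.
have part (p : R -> R) : measurable_fun setT p -> (forall t, 0 <= p t) ->
    (forall t, p t <= `|h t|) -> (forall t, p (t + T) = p t) ->
    [/\ mu.-integrable dom (EFin \o (fun t => p t * NJ alpha t)),
        mu.-integrable dom (EFin \o (fun t => \sum_(k < N) p (fiber k t))) &
        integT (fun t => \sum_(k < N) p (fiber k t)) = integT (fun t => p t * NJ alpha t)].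
  move=> mp p0 ph pT.
  have mpN : measurable_fun setT (fun t => p t * NJ alpha t).
    by apply: measurable_funM => //; exact: measurable_NJ.
  have mpS : measurable_fun setT (fun t => \sum_(k < N) p (fiber k t)).
    by apply: measurable_sum => k; apply: measurableT_comp => //; exact: measurable_fiber.
  have ip : mu.-integrable dom (EFin \o (fun t => p t * NJ alpha t)).
    apply: le_integrable ih; first exact: measurable_dom.
    - by apply/measurable_EFinP; exact: measurable_funTS.
    - move=> t _; rewrite /= lee_fin !normrM ler_wpM2r// ger0_norm// (le_trans (ph t))//.
  have E := ge0_integral_fiber mp p0 pT.
  split => //; last by rewrite /integT /Rintegral E.
  apply/integrableP; split.
    by apply/measurable_EFinP; exact: measurable_funTS.
  have -> : (\int[mu]_(t in dom) `|(\sum_(k < N) p (fiber k t))%:E| =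
      \int[mu]_(t in dom) (\sum_(k < N) p (fiber k t))%:E)%E.
    by apply: eq_integral => t _; rewrite /= ger0_norm// sumr_ge0.
  rewrite E; move/integrableP : ip => [_].
  have -> // : (\int[mu]_(t in dom) `|(p t * NJ alpha t)%:E| =
      \int[mu]_(t in dom) (p t * NJ alpha t)%:E)%E.
  by apply: eq_integral => t _; rewrite /= ger0_norm// mulr_ge0// ltW.
pose hp t := Num.max (h t) 0; pose hn t := Num.max (- h t) 0.
have hE t : h t = hp t - hn t.
  rewrite /hp /hn; have [h0|h0] := leP 0 (h t).
    by rewrite max_r ?oppr_le0// subr0.
  by rewrite max_l ?oppr_ge0 ?ltW// sub0r opprK.
have [|||t|ip1 ip2 ip3] := part hp; rewrite ?hT//.
- by apply: measurable_maxr.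
- by move=> t; rewrite /hp le_max lexx orbT.
- by move=> t; rewrite /hp ge_max ler_norm normr_ge0.
- by rewrite /hp hT.
have [|||t|in1 in2 in3] := part hn.
- by apply: measurable_maxr => //; exact: measurable_funN.
- by move=> t; rewrite /hn le_max lexx orbT.
- by move=> t; rewrite /hn ge_max -normrN ler_norm normr_ge0.
- by rewrite /hn hT.
transitivity (integT (fun t => \sum_(k < N) hp (fiber k t) - \sum_(k < N) hn (fiber k t))).
  by apply: eq_Rintegral => t _; rewrite -sumrB; apply: eq_bigr => k _; exact: hE.
transitivity (integT (fun t => hp t * NJ alpha t - hn t * NJ alpha t)); last first.
  by apply: eq_Rintegral => t _; rewrite -mulrBl -hE.
rewrite /integT !RintegralB//; try exact: measurable_dom.
by rewrite -/(integT _) ip3 -/(integT _) in3.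
Qed.

Lemma measT_comp_blaschke f : measT f -> measT (fun z => f (b z)).
Proof.
move=> /measTP[fr fi]; split; apply: measurable_funTS.
  rewrite (_ : reT _ = reT f \o phi); last by apply/funext => t; rewrite /reT/= bE.
  by apply: measurableT_comp => //; exact: measurable_phi.
rewrite (_ : imT _ = imT f \o phi); last by apply/funext => t; rewrite /imT/= bE.
by apply: measurableT_comp => //; exact: measurable_phi.
Qed.

Let Nc : (N%:R^-1 : C) = (N%:R^-1)%:C%C. Proof. by rewrite fmorphV rmorph_nat. Qed.

Lemma transfer_Re f t :
  Re (L f (eit t)) = N%:R^-1 * \sum_(k < N) Re (f (eit (fiber k t))).
Proof.
rewrite transferE Nc Re_mulc /= mul0r subr0; congr (_ * _).
by apply: (big_ind2 (fun z r => Re z = r)) => // [[? ?] r [? ?] r' <- <-].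
Qed.

Lemma transfer_Im f t :
  Im (L f (eit t)) = N%:R^-1 * \sum_(k < N) Im (f (eit (fiber k t))).
Proof.
rewrite transferE Nc Im_mulc /= mul0r addr0; congr (_ * _).
by apply: (big_ind2 (fun z r => Im z = r)) => // [[? ?] r [? ?] r' <- <-].
Qed.

Lemma measT_transfer f : measT f -> measT (L f).
Proof.
move=> /measTP[fr fi]; split; apply: measurable_funTS.
  rewrite (_ : reT _ = fun t => N%:R^-1 * \sum_(k < N) reT f (fiber k t)).
    apply: measurable_funM => //; apply: measurable_sum => k.
    by apply: measurableT_comp => //; exact: measurable_fiber.
  by apply/funext => t; rewrite /reT transfer_Re.
rewrite (_ : imT _ = fun t => N%:R^-1 * \sum_(k < N) imT f (fiber k t)).
  apply: measurable_funM => //; apply: measurable_sum => k.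
  by apply: measurableT_comp => //; exact: measurable_fiber.
by apply/funext => t; rewrite /imT transfer_Im.
Qed.

Lemma aeq_comp_blaschke f g : aeq f g -> aeq (fun z => f (b z)) (fun z => g (b z)).
Proof. exact: (@aeT_blaschke (fun z => f z = g z)). Qed.

Lemma aeq_transfer f g : aeq f g -> aeq (L f) (L g).
Proof.
move=> /(@aeT_fiber (fun z => f z = g z)); apply: aeT_sub => t _ H.
by rewrite !transferE; congr (_ * _); apply: eq_bigr.
Qed.

Lemma transfer_module f g t :
  L (fun w => f (b w) * g w) (eit t) = f (eit t) * L g (eit t).
Proof.
rewrite !transferE mulrCA; congr (_ * _); rewrite mulr_sumr.
by apply: eq_bigr => k _; rewrite blaschke_fiber.
Qed.

Lemma transfer_nsq f t :
  L (fun w => (f w)^* * f w) (eit t) =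
  (N%:R^-1 * \sum_(k < N) nsq (f (eit (fiber k t))))%:C%C.
Proof.
apply: complex_ext; rewrite ?transfer_Re ?transfer_Im /=.
  by congr (_ * _); apply: eq_bigr => k _; rewrite conj_mul_nsq.
by rewrite big1 ?mulr0// => k _; rewrite conj_mul_nsq.
Qed.

(** The point e^{it} belongs to its own fibre, with index 0, so one term of the sum is already
    |f|^2. *)
Lemma nsq_le_transfer f t : 
  nsq (f (eit t)) <= N%:R * (N%:R^-1 * \sum_(k < N) nsq (f (eit (fiber k (phi t))))).
Proof.
rewrite mulVKf ?gt_eqF// (bigD1 (Ordinal N0))//= fiber0_phi lerDl sumr_ge0// => k _.
exact: nsq_ge0.
Qed.

Lemma Jhalf_neq0 t : J (eit t) != 0.
Proof. by rewrite -nsq_eq0 -abs2TE abs2_Jhalf// gt_eqF// divr_gt0. Qed.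

Lemma cintT_transfer f :
  mu.-integrable dom (EFin \o (fun t => Re (f (eit t)) * NJ alpha t)) ->
  mu.-integrable dom (EFin \o (fun t => Im (f (eit t)) * NJ alpha t)) ->
  measT f ->
  cintT (fun t => L f (eit t)) = cintT (fun t => (NJ alpha t / N%:R)%:C%C * f (eit t)).
Proof.
move=> ir ii /measTP[fr fi].
have part (p : R -> R) : measurable_fun setT p -> (forall t, p (t + T) = p t) ->
    mu.-integrable dom (EFin \o (fun t => p t * NJ alpha t)) ->
    integT (fun t => N%:R^-1 * \sum_(k < N) p (fiber k t)) =
    integT (fun t => NJ alpha t / N%:R * p t).
  move=> mp pT ip.
  transitivity (integT (fun t => \sum_(k < N) N%:R^-1 * p (fiber k t))).
    by apply: eq_Rintegral => t _; rewrite mulr_sumr.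
  rewrite (@integT_fiber (fun t => N%:R^-1 * p t)).
  - by apply: eq_Rintegral => t _; rewrite mulrC mulrA.
  - exact: measurable_funM.
  - by move=> t; rewrite pT.
  apply: le_integrable ip; first exact: measurable_dom.
  - apply/measurable_EFinP; apply: measurable_funTS; apply: measurable_funM.
      exact: measurable_funM.
    exact: measurable_NJ.
  - move=> t _; rewrite /= lee_fin -mulrA normrM ler_piMl// ger0_norm ?invr_ge0 ?ler0n//.
    by rewrite invf_le1// ler1n.
rewrite /cintT; congr ((_ +i* _)%C / _).
  transitivity (integT (fun t => N%:R^-1 * \sum_(k < N) reT f (fiber k t))).
    by apply: eq_Rintegral => t _; rewrite transfer_Re.
  rewrite part//; last exact: reT_2pi.
  by apply: eq_Rintegral => t _; rewrite Re_mulc /= mul0r subr0.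
transitivity (integT (fun t => N%:R^-1 * \sum_(k < N) imT f (fiber k t))).
  by apply: eq_Rintegral => t _; rewrite transfer_Im.
rewrite part//; last exact: imT_2pi.
by apply: eq_Rintegral => t _; rewrite Im_mulc /= mul0r addr0.
Qed.


(** * The operators pi(m) C_b and their adjoints *)

Lemma nsq_Jhalf t : nsq (J (eit t)) = NJ alpha t / N%:R.
Proof. by rewrite -abs2TE abs2_Jhalf. Qed.

Lemma Linf_Jhalf : Linf J.
Proof.
have [M _ HM] := continuous_periodic_max (continuous_NJ alpha_lt1) (NJ_2pi alpha).
apply: (@Linf_bounded _ _ (M / N%:R)); first exact: measT_Jhalf.
move=> t; rewrite abs2_Jhalf// ler_pM2r ?invr_gt0//.
by apply: le_trans (HM t); exact: ler_norm.
Qed.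

Lemma measurable_abs2T_setT f : measT f -> measurable_fun setT (abs2T f).
Proof.
move=> mf; apply: measurable_periodic; last exact: measurable_abs2T.
by move=> t; rewrite !abs2TE eit_2pi.
Qed.

Lemma measT_mCb m f : measT m -> measT f -> measT (mCb alpha m f).
Proof.
move=> mm mf; apply: measT_mul => //; apply: measT_mul; first exact: measT_Jhalf.
exact: measT_comp_blaschke.
Qed.

(* The candidate for the adjoint of [mCb alpha m]. *)
Definition mCb_adj m g z := L (fun w => (m w)^* * (g w / J w)) z.

Lemma measT_mCb_adj m g : measT m -> measT g -> measT (mCb_adj m g).
Proof.
move=> mm mg; apply: measT_transfer; apply: measT_mul; first exact: measT_conj.
by apply: measT_mul => //; apply: measT_inv; exact: measT_Jhalf.
Qed.

(** |J^{1/2}|^2 = J_0 is the weight of the fibre formula, so the integrand becomes |f|^2 L(|m|^2).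
    As f is merely measurable here, the identity also yields square integrability of the image. *)
Lemma int_abs2_mCb m f : measT m -> measT f ->
  aeq (L (fun w => (m w)^* * m w)) (fun=> 1) ->
  int_abs2 (mCb alpha m f) = int_abs2 f.
Proof.
move=> mm mf m1.
pose h t := abs2T m t * (abs2T f (phi t) / N%:R).
have mh : measurable_fun setT h.
  apply: measurable_funM; first exact: measurable_abs2T_setT.
  apply: measurable_funM => //; apply: measurableT_comp; last exact: measurable_phi.
  exact: measurable_abs2T_setT.
have h0 t : 0 <= h t by rewrite !mulr_ge0 ?abs2T_ge0// invr_ge0 ltW.
have hT t : h (t + T) = h t.
  by rewrite /h !abs2TE -!bE eit_2pi.
transitivity (\int[mu]_(t in dom) (h t * NJ alpha t)%:E)%E.
  apply: eq_integral => t _; congr (_%:E).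
  by rewrite abs2TE /mCb /Cb !nsqM nsq_Jhalf bE /h !abs2TE; ring.
rewrite -ge0_integral_fiber//.
have E t : \sum_(k < N) h (fiber k t) =
    abs2T f t * (N%:R^-1 * \sum_(k < N) nsq (m (eit (fiber k t)))).
  rewrite mulrA mulr_sumr; apply: eq_bigr => k _.
  by rewrite /h !abs2TE -bE blaschke_fiber mulrC.
apply: ae_eq_integral => //; first exact: measurable_dom.
- apply/measurable_EFinP; apply: measurable_funTS; apply: measurable_sum => k.
  by apply: measurableT_comp => //; exact: measurable_fiber.
- by apply/measurable_EFinP; exact: measurable_abs2T.
- have /aeTP : aeT (fun t => \sum_(k < N) h (fiber k t) = abs2T f t).
    apply: aeT_sub m1 => t _; rewrite transfer_nsq E => -[->].
    by rewrite mulr1.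
  by apply: negligibleS; apply: subsetC => t /= H dt; rewrite H.
Qed.

Lemma orthonormal_bounded m : aeq (L (fun w => (m w)^* * m w)) (fun=> 1) ->
  aeT (fun t => abs2T m t <= N%:R).
Proof.
move=> /(@aeT_blaschke (fun z => L (fun w => (m w)^* * m w) z = 1)).
apply: aeT_sub => t _; rewrite bE transfer_nsq => -[e].
by rewrite abs2TE (le_trans (nsq_le_transfer m t))// e mulr1.
Qed.

Lemma int_abs2_mCb_adj m g : measT m -> measT g ->
  aeT (fun t => abs2T m t <= N%:R) ->
  (int_abs2 (mCb_adj m g) <= (2 ^+ N)%:E * int_abs2 g)%E.
Proof.
move=> mm mg mN.
have p2 : 0 <= 2 ^+ N :> R by rewrite exprn_ge0.
(* Chosen so that h NJ = 2^N |g|^2, while |m|^2 <= N and |J^{1/2}|^2 = NJ / N make the fibre sum of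
   h dominate the squared image. The factor 2^N is that of [nsq_sum]. *)
pose h t := 2 ^+ N * (abs2T g t / NJ alpha t).
have mh : measurable_fun setT h.
  apply: measurable_funM => //; apply: measurable_funM.
    exact: measurable_abs2T_setT.
  by apply: measurable_invr_ge0; [exact: measurable_NJ|move=> t; exact: ltW].
have h0 t : 0 <= h t by rewrite mulr_ge0// divr_ge0 ?abs2T_ge0// ltW.
have hT t : h (t + T) = h t by rewrite /h !abs2TE eit_2pi NJ_2pi.
rewrite /int_abs2 -ge0_integralZl//; last first.
- by move=> t _; rewrite lee_fin abs2T_ge0.
- by apply/measurable_EFinP; exact: measurable_abs2T.
- exact: measurable_dom.
have -> : (\int[mu]_(t in dom) ((2 ^+ N)%:E * (abs2T g t)%:E) =
    \int[mu]_(t in dom) (h t * NJ alpha t)%:E)%E.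
  apply: eq_integral => t _; rewrite -EFinM; congr (_%:E).
  by rewrite /h -mulrA divfK// gt_eqF.
rewrite -ge0_integral_fiber//.
have mS : measurable_fun setT (fun t => \sum_(k < N) h (fiber k t)).
  by apply: measurable_sum => k; apply: measurableT_comp => //; exact: measurable_fiber.
apply: ae_ge0_le_integral => //.
- exact: measurable_dom.
- by move=> t _; rewrite lee_fin abs2T_ge0.
- by apply/measurable_EFinP; apply: measurable_abs2T; exact: measT_mCb_adj.
- by move=> t _; rewrite lee_fin sumr_ge0.
- by apply/measurable_EFinP; exact: measurable_funTS.
have mN' : aeT (fun t => nsq (m (eit t)) <= N%:R) by [].
have /aeTP : aeT (fun t => abs2T (mCb_adj m g) t <= \sum_(k < N) h (fiber k t)).
  apply: aeT_sub (@aeT_fiber (fun z => nsq (m z) <= N%:R) mN') => t _ H.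
  rewrite abs2TE /mCb_adj transferE nsqM Nc nsq_real.
  apply: (@le_trans _ _ (N%:R^-1 ^+ 2 * (2 ^+ N * \sum_(k < N)
      nsq ((m (eit (fiber k t)))^* * (g (eit (fiber k t)) / J (eit (fiber k t))))))).
    by rewrite ler_wpM2l ?sqr_ge0// nsq_sum.
  rewrite /h -mulr_sumr mulrCA ler_wpM2l// mulr_sumr ler_sum// => k _.
  rewrite !nsqM nsq_conj nsqV nsq_Jhalf invf_div abs2TE.
  rewrite [leLHS](_ : _ = (nsq (m (eit (fiber k t))) / N%:R) *
     (nsq (g (eit (fiber k t))) / NJ alpha (fiber k t))); last first.
    by field; rewrite !gt_eqF.
  rewrite ler_piMl ?divr_ge0 ?nsq_ge0 ?(ltW (NJ0 _))//.
  by rewrite ler_pdivrMr// mul1r.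
by apply: negligibleS; apply: subsetC => t H dt; rewrite lee_fin; exact: H.
Qed.

(* On the circle [conj (m J (f o b)) g = J_0 conj (m (f o b)) (g / J)], so
   that [cintT_transfer] applies. *)
Lemma inner_mCb m f g : measT m -> measT f -> measT g ->
  mu.-integrable dom (EFin \o (fun t => Re ((mCb alpha m f (eit t))^* * g (eit t)))) ->
  mu.-integrable dom (EFin \o (fun t => Im ((mCb alpha m f (eit t))^* * g (eit t)))) ->
  inner (mCb alpha m f) g = inner f (mCb_adj m g).
Proof.
move=> mm mf mg ir ii.
pose k w := (f (b w))^* * ((m w)^* * (g w / J w)).
have kE t : (mCb alpha m f (eit t))^* * g (eit t) =
    (NJ alpha t / N%:R)%:C%C * k (eit t).
  rewrite -nsq_Jhalf -conj_mul_nsq /mCb /Cb /k !rmorphM/=.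
  by field; exact: Jhalf_neq0.
have part (p q : R -> R) : (forall t, p t = NJ alpha t / N%:R * q t) ->
    mu.-integrable dom (EFin \o p) ->
    mu.-integrable dom (EFin \o (fun t => q t * NJ alpha t)).
  move=> pq ip.
  have {ip} : mu.-integrable dom (fun t => N%:R%:E * (EFin \o p) t)%E.
    by apply: integrableZl => //; exact: measurable_dom.
  rewrite (_ : (fun x => _) = EFin \o (fun t => q t * NJ alpha t))//.
  by apply/funext => t; rewrite /= pq -EFinM; congr (_%:E); field; rewrite gt_eqF.
rewrite /inner.
under [in LHS]eq_fun do rewrite kE.
rewrite -cintT_transfer.
- congr (cintT _); apply/funext => t.
  exact: (transfer_module (fun z => (f z)^*)).
- by apply: part ir => t; rewrite kE Re_mulc /= mul0r subr0.
- by apply: part ii => t; rewrite kE Im_mulc /= mul0r addr0.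
- apply: measT_mul; first exact/measT_conj/measT_comp_blaschke.
  apply: measT_mul; first exact: measT_conj.
  by apply: measT_mul => //; apply: measT_inv; exact: measT_Jhalf.
Qed.


Lemma mCb_aeq m f g : aeq f g -> aeq (mCb alpha m f) (mCb alpha m g).
Proof. by move=> /aeq_comp_blaschke; apply: aeT_sub => t _; rewrite /mCb /Cb => ->. Qed.

Lemma mCb_adj_aeq m f g : aeq f g -> aeq (mCb_adj m f) (mCb_adj m g).
Proof. by move=> fg; apply: aeq_transfer; apply: aeT_sub fg => t _ ->. Qed.

Lemma mCb_adj_mCb m m' f :
  aeq (mCb_adj m (mCb alpha m' f)) (fun z => f z * L (fun w => (m w)^* * m' w) z).
Proof.
apply: aeq_pointwise => t; rewrite -transfer_module /mCb_adj !transferE.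
congr (_ * _); apply: eq_bigr => k _; rewrite /mCb /Cb.
by field; exact: Jhalf_neq0.
Qed.

(** The weight 1 / (1 + |f|^2) and its product with f are both bounded, and the weight never
    vanishes, so it can be cancelled afterwards. *)
Lemma measT_regularized f : measT f ->
  measT (fun z => (1 + (nsq (f z))%:C%C)^-1) /\
  forall z, (1 + (nsq (f z))%:C%C)^-1 = ((1 + nsq (f z))^-1)%:C%C :> C.
Proof.
move=> mf; split; last by move=> z; rewrite [in RHS]fmorphV [in RHS]rmorphD.
by apply: measT_inv; apply: measT_add; [exact: measT_cst|exact: measT_nsq].
Qed.

(** Stated with a majorant r of x = |f|^2, to serve both for r = |f|^2 and for r = N L(|f|^2) o
    b. *)
Lemma nsq_regularized (r x : R) : 0 <= r -> x <= r -> 0 <= x ->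
  (1 + r)^-1 ^+ 2 * x <= 1.
Proof.
move=> r0 xr x0; rewrite exprVn mulrC ler_pdivrMr ?exprn_gt0 ?ltr_pwDl// mul1r.
nra.
Qed.

Lemma Linf_regularizer f : measT f -> Linf (fun z => (1 + (nsq (f z))%:C%C)^-1).
Proof.
move=> mf; have [mr rE] := measT_regularized mf.
apply: (@Linf_bounded _ _ 1) => // t; rewrite abs2TE rE nsq_real exprVn.
rewrite invf_le1 ?exprn_gt0 ?ltr_pwDl ?nsq_ge0//.
by rewrite exprn_ege1// lerDl nsq_ge0.
Qed.

Lemma Linf_regularized f : measT f -> Linf (fun z => (1 + (nsq (f z))%:C%C)^-1 * f z).
Proof.
move=> mf; have [mr rE] := measT_regularized mf.
apply: (@Linf_bounded _ _ 1); first exact: measT_mul.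
by move=> t; rewrite abs2TE nsqM rE nsq_real nsq_regularized ?nsq_ge0.
Qed.

Lemma regularizer_neq0 f z : (1 + (nsq (f z))%:C%C)^-1 != 0 :> C.
Proof.
rewrite invr_eq0 -(rmorph1 (real_complex R)) -rmorphD /= eq_complex /= eqxx andbT.
by rewrite gt_eqF// ltr_pwDl ?nsq_ge0.
Qed.

Lemma L2_aeq f g : measT g -> L2 f -> aeq f g -> L2 g.
Proof.
move=> mg Lf fg; apply: (L2_le (c := 1)) Lf _ => //.
by apply: aeT_sub fg => t _ e; rewrite !abs2TE e mul1r.
Qed.

Lemma inner_aeq_l f g k : measT f -> measT g -> measT k -> aeq f g ->
  inner f k = inner g k.
Proof.
move=> mf mg mk fg; rewrite /inner /cintT.
have [ffr ffi] := measT_mul (measT_conj mf) mk.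
have [gfr gfi] := measT_mul (measT_conj mg) mk.
congr ((_ +i* _)%C / _); apply: integT_aeq => //; apply: aeT_sub fg => t _ -> //.
Qed.

Lemma inner_eq_Re f g k : inner f g = inner f k ->
  integT (fun t => Re ((f (eit t))^* * g (eit t))) =
  integT (fun t => Re ((f (eit t))^* * k (eit t))).
Proof.
rewrite /inner /cintT => /(divIf _)-H.
have p0 : (pi *+ 2)%:C%C != 0 :> C.
  by rewrite eq_complex /= eqxx andbT gt_eqF// tpi_gt0.
by have [] := H p0.
Qed.

(* If [G] is the difference of two functions with the same pairing against
   every bounded function, pairing with [G / (1 + |G|^2)] shows [G = 0]. *)
Lemma adjoint_unique (S A : op) m g : is_adjoint S A -> (forall f, L2 f -> L2 (S f)) ->
  measT m -> (forall f, L2 f -> aeq (S f) (mCb alpha m f)) -> L2 g ->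
  aeq (A g) (mCb_adj m g).
Proof.
move=> [[AL _ _ _] adj] SL mm Sm Lg.
have [mg _] := Lg; have [mA _] := AL g Lg.
have mB := measT_mCb_adj mm mg.
pose G z := A g z + - mCb_adj m g z.
have mG : measT G.
  apply: measT_add => //; rewrite (_ : (fun z => _) = fun z => cst (-1) z * mCb_adj m g z).
    by apply: measT_mul => //; exact: measT_cst.
  by apply/funext => z; rewrite mulN1r.
have [mr rE] := measT_regularized mG.
pose f z := (1 + (nsq (G z))%:C%C)^-1 * G z.
have Lf : L2 f by apply: Linf_L2; exact: Linf_regularized.
have [mf _] := Lf; have mCf := measT_mCb mm mf.
(* As m is only measurable, square integrability is inherited from S f rather than from a bound on
   m. *)
have LCf : L2 (mCb alpha m f) by exact: L2_aeq (SL _ Lf) (Sm _ Lf).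
have [ir ii] := L2_conjM_integrable LCf Lg.
have fE : inner f (A g) = inner f (mCb_adj m g).
  rewrite -adj// -inner_mCb//; apply: inner_aeq_l => //; last exact: Sm.
  by have [] := SL _ Lf.
pose q t := (1 + nsq (G (eit t)))^-1 * nsq (G (eit t)).
have qE t : Re ((f (eit t))^* * G (eit t)) = q t.
  rewrite /f rmorphM/= -mulrA conj_mul_nsq rE /q.
  by rewrite Re_mulc /= mulr0 subr0.
have q0 t : 0 <= q t by rewrite /q mulr_ge0 ?nsq_ge0// invr_ge0 addr_ge0 ?nsq_ge0.
have q1 t : q t <= 1.
  by rewrite /q mulrC ler_pdivrMr ?ltr_pwDl ?nsq_ge0// mul1r lerDr.
have mq : measurable_fun dom q.
  have [H _] := measT_mul (measT_conj mf) mG.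
  by rewrite (_ : q = reT (fun z => (f z)^* * G z))//; apply/funext => t; rewrite -qE.
have iq : mu.-integrable dom (EFin \o q).
  by apply: (@bounded_integrable_dom _ _ 1) => // t _; rewrite ger0_norm.
have [iA _] := L2_conjM_integrable Lf (AL _ Lg).
have Iq : integT q = 0.
  have BE t : Re ((f (eit t))^* * mCb_adj m g (eit t)) =
      Re ((f (eit t))^* * A g (eit t)) - q t.
    rewrite -qE /G mulrDr mulrN.
    by case: (_ * A g _) => ? ?; case: (_ * mCb_adj _ _ _) => ? ? /=; ring.
  have := inner_eq_Re fE; rewrite /integT; under [RHS]eq_Rintegral do rewrite BE.
  rewrite RintegralB//; last exact: measurable_dom.
  by move=> /eqP; rewrite eq_sym subr_eq addrC -subr_eq subrr eq_sym => /eqP.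
have {Iq} Iq : (\int[mu]_(t in dom) (q t)%:E = 0)%E.
  have h : (\int[mu]_(t in dom) (q t)%:E)%E \is a fin_num.
    by apply: integrable_fin_num => //; exact: measurable_dom.
  by rewrite -(fineK h); congr (_%:E).
apply: aeT_sub (aeT_eq0_integral mq q0 Iq) => t _ /eqP.
rewrite mulf_eq0 invr_eq0 nsq_eq0 gt_eqF ?ltr_pwDl ?nsq_ge0//= => /eqP.
by rewrite /G => /eqP; rewrite subr_eq0 => /eqP.
Qed.

(** * Cuntz families and orthonormal bases *)

Lemma cuntz_family_onb (S A : 'I_N -> op) (m : 'I_N -> C -> C) :
  cuntz_family S A -> (forall i, measT (m i)) ->
  (forall i f, L2 f -> aeq (S i f) (mCb alpha (m i) f)) -> onb alpha m.
Proof.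
move=> [Sb Sadj SS1 SS2] mm Sm.
have SL i f : L2 f -> L2 (S i f) by case: (Sb i) => + _ _ _; apply.
have AE i g : L2 g -> aeq (A i g) (mCb_adj (m i) g).
  by move=> Lg; apply: adjoint_unique (Sadj i) (SL i) (mm i) (Sm i) Lg.
(* Test on the constant 1: A_i S_j 1 is delta_ij by the Cuntz relation and L(conj m_i m_j) by the
   adjoint formula. *)
have orth i j : aeq (L (fun w => (m i w)^* * m j w)) (fun=> (i == j)%:R).
  have L1 := L2_cst (1 : C).
  have H1 := AE i _ (SL j _ L1).
  have H2 := mCb_adj_aeq (m i) (Sm j _ L1).
  have H3 := aeq_trans (aeq_trans H1 H2) (mCb_adj_mCb (m i) (m j) (cst 1)).
  have H4 := aeq_trans (aeq_sym H3) (SS1 i j _ L1).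
  by apply: aeT_sub H4 => t _; rewrite mul1r mulr1.
have mLinf i : Linf (m i).
  split => //; exists N%:R; apply: orthonormal_bounded.
  by have := orth i i; rewrite eqxx.
split => // f Lf.
have [mf _] := Lf.
(* Completeness at f is the relation sum_i S_i A_i = 1 at J f: there A_i gives L(conj m_i f), and
   the factor J reappears in S_i and cancels. *)
have LJf : L2 (fun z => J z * f z) by apply: Linf_mul_L2; [exact: Linf_Jhalf|exact: Linf_L2].
have AJ i : aeq (A i (fun z => J z * f z)) (L (fun w => (m i w)^* * f w)).
  apply: aeq_trans (AE i _ LJf) _; apply: aeq_transfer; apply: aeq_pointwise => t.
  by field; exact: Jhalf_neq0.
have LA i : L2 (A i (fun z => J z * f z)).
  by have [[AL _ _ _] _] := Sadj i; exact: AL.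
have SA i : aeq (S i (A i (fun z => J z * f z)))
    (mCb alpha (m i) (L (fun w => (m i w)^* * f w))).
  by apply: aeq_trans (Sm i _ (LA i)) _; exact: mCb_aeq.
apply: aeT_sub2 (aeT_ord SA) (SS2 _ LJf) => t _ H /= e.
apply: (mulfI (Jhalf_neq0 t)); rewrite -e mulr_sumr; apply: eq_bigr => i _.
by rewrite H /mCb /Cb mulrCA.
Qed.

(** Evaluate covariance at S_j g: since A_i S_j g = delta_ij g, only the term S_j (p g) survives. *)
Lemma cuntz_covariant_mul (S A : 'I_N -> op) :
  cuntz_family S A -> alpha_cov S A b -> forall j p g, Linf p -> L2 g ->
  aeq (S j (fun z => p z * g z)) (fun z => p (b z) * S j g z).
Proof.
move=> [Sb Sadj SS1 SS2] cov j p g Lp Lg.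
have SL i f : L2 f -> L2 (S i f) by case: (Sb i) => + _ _ _; apply.
have L0 : L2 (fun=> 0 : C) by exact: (L2_cst 0).
(* Linearity at 0 reads S_i 0 = S_i 0 + S_i 0. *)
have S0 i : aeq (S i (fun=> 0)) (fun=> 0).
  have [_ _ Slin _] := Sb i; have := Slin 1 (fun=> 0) (fun=> 0) L0 L0.
  rewrite (_ : (fun z => 1 * 0 + 0) = (fun=> 0)); last by apply/funext => z; rewrite mulr0 addr0.
  apply: aeT_sub => t _ /eqP; rewrite mul1r -subr_eq0 opprD addrA subrr sub0r oppr_eq0.
  by move/eqP.
have Lpg : L2 (fun z => p z * g z) by exact: Linf_mul_L2.
have T1 i : aeq (S i (fun w => p w * A i (S j g) w))
    (fun z => (i == j)%:R * S j (fun z => p z * g z) z).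
  have [_ Seq _ _] := Sb i.
  have LA : L2 (fun w => p w * A i (S j g) w).
    by apply: Linf_mul_L2 => //; have [[AL _ _ _] _] := Sadj i; exact/AL/SL.
  have [ij|ij] := eqVneq i j.
    have E : aeq (fun w => p w * A i (S j g) w) (fun z => p z * g z).
      by apply: aeT_sub (SS1 i j g Lg) => t _ ->; rewrite ij eqxx mul1r.
    by apply: aeT_sub (Seq _ _ LA Lpg E) => t _ ->; rewrite ij mul1r.
  have E : aeq (fun w => p w * A i (S j g) w) (fun=> 0).
    by apply: aeT_sub (SS1 i j g Lg) => t _ ->; rewrite (negbTE ij) mul0r mulr0.
  by apply: aeT_sub (aeq_trans (Seq _ _ LA L0 E) (S0 i)) => t _ ->; rewrite mul0r.
apply: aeT_sub2 (aeT_ord T1) (cov p Lp _ (SL j g Lg)) => t _ H <-.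
rewrite (bigD1 j)//= H eqxx mul1r big1 ?addr0// => i ij.
by rewrite H (negbTE ij) mul0r.
Qed.

Lemma cuntz_covariant_form (S A : 'I_N -> op) :
  cuntz_family S A -> alpha_cov S A b ->
  exists m : 'I_N -> C -> C, onb alpha m /\
    forall i f, L2 f -> aeq (S i f) (mCb alpha (m i) f).
Proof.
move=> cS cov; have [Sb Sadj SS1 SS2] := cS.
have SL i f : L2 f -> L2 (S i f) by case: (Sb i) => + _ _ _; apply.
pose m i z := S i (cst 1) z / J z.
have L1 := L2_cst (1 : C).
have mm i : measT (m i).
  apply: measT_mul; first by have [] := SL i _ L1.
  by apply: measT_inv; exact: measT_Jhalf.
have Sm i f : L2 f -> aeq (S i f) (mCb alpha (m i) f).
  move=> Lf; have [mf _] := Lf.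
  (* An unbounded f cannot itself be the multiplier. With p = 1 / (1 + |f|^2), S_i (p f) is computed
     twice, with p acting on f and with p f acting on 1; cancelling p o b leaves S_i f = (f o b) S_i
     1. *)
  have H1 := cuntz_covariant_mul cS cov i (Linf_regularizer mf) Lf.
  have H2 := cuntz_covariant_mul cS cov i (Linf_regularized mf) L1.
  have [_ Seq _ _] := Sb i.
  have La := Linf_L2 (Linf_regularized mf).
  have Lb : L2 (fun z => ((1 + (nsq (f z))%:C%C)^-1 * f z) * cst 1 z).
    by apply: Linf_mul_L2 => //; exact: Linf_regularized.
  have H3 := Seq _ _ La Lb (aeq_pointwise (fun t => esym (mulr1 _))).
  apply: aeT_sub2 (aeT_and H1 H2) H3 => t _ [h1 h2] h3.
  apply: (mulfI (regularizer_neq0 f (b (eit t)))).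
  have -> : mCb alpha (m i) f (eit t) = f (b (eit t)) * S i (cst 1) (eit t).
    by rewrite /mCb /Cb /m mulrA divfK ?Jhalf_neq0// mulrC.
  by rewrite -h1 h3 h2 mulrA.
by exists m; split => //; exact: cuntz_family_onb cS mm Sm.
Qed.

(* Completeness extends from bounded to measurable functions: multiply [h]
   by a bounded function of [b] that makes it bounded, and cancel. *)
Lemma onb_complete (m : 'I_N -> C -> C) (h : C -> C) : onb alpha m -> measT h ->
  aeq h (fun z => \sum_(i < N) m i z * L (fun w => (m i w)^* * h w) (b z)).
Proof.
move=> [mL orth compl] mh.
pose q z := L (fun w => (nsq (h w))%:C%C) z.
(* N L(|h|^2) o b dominates |h|^2 by [nsq_le_transfer], so F o b makes h bounded; being a function
   of b, it passes through L. *)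
pose F z := (1 + N%:R * q z)^-1.
have mF : measT F.
  apply: measT_inv; apply: measT_add; first exact: measT_cst.
  apply: measT_mul; first exact: measT_cst.
  by apply: measT_transfer; exact: measT_nsq.
have mFb := measT_comp_blaschke mF.
pose r t := N%:R * (N%:R^-1 * \sum_(k < N) nsq (h (eit (fiber k t)))).
have r0 t : 0 <= r t by rewrite !mulr_ge0 ?invr_ge0 ?ler0n ?sumr_ge0// => k _; exact: nsq_ge0.
have FE t : F (eit t) = ((1 + r t)^-1)%:C%C.
  rewrite /F /q (_ : (fun w => (nsq (h w))%:C%C) = (fun w => (h w)^* * h w)).
    by rewrite transfer_nsq [in RHS]fmorphV [in RHS]rmorphD [in RHS]/r [in RHS]rmorphM rmorph_nat.
  by apply/funext => w; rewrite conj_mul_nsq.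
have LFh : Linf (fun z => F (b z) * h z).
  apply: (@Linf_bounded _ _ 1); first exact: measT_mul.
  move=> t; rewrite abs2TE nsqM bE FE nsq_real nsq_regularized ?nsq_ge0//.
  exact: nsq_le_transfer.
apply: aeT_sub (compl _ LFh) => t _ e.
have F0 : F (b (eit t)) != 0.
  by rewrite bE FE eq_complex /= eqxx andbT invr_eq0 gt_eqF// ltr_pwDl.
apply: (mulfI F0); rewrite e mulr_sumr; apply: eq_bigr => i _.
have -> : L (fun w => (m i w)^* * (F (b w) * h w)) (b (eit t)) =
    F (b (eit t)) * L (fun w => (m i w)^* * h w) (b (eit t)).
  rewrite bE -(transfer_module F) !transferE; congr (_ * _).
  by apply: eq_bigr => k _; rewrite mulrCA.
by rewrite mulrCA.
Qed.

Lemma onb_cuntz (m : 'I_N -> C -> C) : onb alpha m ->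
  cuntz_family (fun i => mCb alpha (m i)) (fun i => mCb_adj (m i)) /\
  alpha_cov (fun i => mCb alpha (m i)) (fun i => mCb_adj (m i)) b.
Proof.
move=> onbm; have [mL orth compl] := onbm.
have mm i : measT (m i) by have [] := mL i.
have orth1 i : aeq (L (fun w => (m i w)^* * m i w)) (fun=> 1).
  by have := orth i i; rewrite eqxx.
have SL i f : L2 f -> L2 (mCb alpha (m i) f).
  by move=> /L2P[mf If]; apply/L2P; split; [exact: measT_mCb|rewrite int_abs2_mCb].
have p2 : 0 <= 2 ^+ N :> R by rewrite exprn_ge0.
have Aint i g : measT g -> (int_abs2 (mCb_adj (m i) g) <= (2 ^+ N)%:E * int_abs2 g)%E.
  by move=> mg; apply: int_abs2_mCb_adj => //; exact: orthonormal_bounded.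
have AL i g : L2 g -> L2 (mCb_adj (m i) g).
  move=> /L2P[mg Ig]; apply/L2P; split; first exact: measT_mCb_adj.
  apply: (le_lt_trans (Aint i g mg)).
  by rewrite lte_mul_pinfty// ge0_fin_numE// int_abs2_ge0.
(* Completeness is used at g / J^{1/2}, which need not be bounded. *)
have res g : L2 g ->
    aeq (fun z => \sum_(i < N) mCb alpha (m i) (mCb_adj (m i) g) z) g.
  move=> [mg _].
  have mgJ : measT (fun z => g z / J z).
    by apply: measT_mul => //; apply: measT_inv; exact: measT_Jhalf.
  apply: aeT_sub (onb_complete onbm mgJ) => t _ e.
  rewrite -[RHS](divfK (Jhalf_neq0 t)) e mulr_suml; apply: eq_bigr => i _.
  by rewrite /mCb /Cb /mCb_adj mulrA mulrAC.
split; first split => //.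
- move=> i; split; first exact: SL.
  + by move=> f g _ _; exact: mCb_aeq.
  + by move=> a f g _ _; apply: aeq_pointwise => t; rewrite /mCb /Cb; ring.
  + exists 1 => f Lf; have [mf _] := Lf.
    by rewrite -[X in X * _](sqrtr1 R); apply: norm2_le; rewrite ?int_abs2_mCb ?mul1e.
- move=> i; split; first split.
  + exact: AL.
  + by move=> f g _ _; exact: mCb_adj_aeq.
  + move=> a f g _ _; apply: aeq_pointwise => t; rewrite /mCb_adj !transferE.
    rewrite mulrCA -mulrDr; congr (_ * _); rewrite mulr_sumr -big_split/=.
    by apply: eq_bigr => k _; ring.
  + exists (Num.sqrt (2 ^+ N)) => g Lg; have [mg _] := Lg.
    by apply: norm2_le => //; exact: Aint.
  + move=> f g Lf Lg; have [mf _] := Lf; have [mg _] := Lg.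
    by have [ir ii] := L2_conjM_integrable (SL i f Lf) Lg; exact: inner_mCb.
- move=> i j f _; apply: aeq_trans (mCb_adj_mCb _ _ _) _.
  by apply: aeT_sub (orth i j) => t _ ->; rewrite mulrC.
- move=> p Lp f Lf; apply: aeT_sub (res f Lf) => t _ <-.
  by rewrite mulr_sumr; apply: eq_bigr => i _; rewrite /mCb /Cb; ring.
Qed.

End fiber_transport.

Theorem theorem5p1 (R : realType) (N : nat) (alpha : 'I_N -> R[i])
  (HN : (0 < N)%N) (Ha : forall j, `|alpha j| < 1) :
  [/\
   (* (1) *)
   (forall S A : 'I_N -> op, cuntz_family S A -> alpha_cov S A (blaschke alpha) ->
      exists m : 'I_N -> R[i] -> R[i], onb alpha m /\
        forall i f, L2 f -> aeq (S i f) (mCb alpha (m i) f)),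
   (* (2) *)
   (forall m : 'I_N -> R[i] -> R[i], (forall i, Linf (m i)) ->
      forall A : 'I_N -> op,
        cuntz_family (fun i => mCb alpha (m i)) A ->
        alpha_cov (fun i => mCb alpha (m i)) A (blaschke alpha) ->
      onb alpha m) &
   (* (3) *)
   (forall m : 'I_N -> R[i] -> R[i], onb alpha m ->
      exists A : 'I_N -> op,
        cuntz_family (fun i => mCb alpha (m i)) A /\
        alpha_cov (fun i => mCb alpha (m i)) A (blaschke alpha))].
Proof.
have [phi [psi [bE dphi [phiK psiK] phi_mono phiT]]] := blaschke_lift HN Ha.
split.
- move=> S A cS cov; exact: (cuntz_covariant_form HN Ha bE dphi phiK psiK phi_mono phiT cS cov).
- move=> m mL A cS _.
  apply: (cuntz_family_onb HN Ha bE dphi phiK psiK phi_mono phiT cS) => [i|i f _].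
    by have [] := mL i.
  exact: aeq_refl.
- move=> m onbm; exists (fun i => mCb_adj alpha (m i)).
  exact: (onb_cuntz HN Ha bE dphi phiK psiK phi_mono phiT onbm).
Qed.
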